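(* Let $K$ be a field and $\mathcal D$ a nonempty (graded) set. Let $\langle\,,\rangle$ be the Hopf pairing on $\mathcal H^{\mathcal D}$ induced by the unique bidendriform pairing on $\mathcal A^{\mathcal D}$ such that $\langle\bullet_d,\bullet_{d'}\rangle=\delta_{d,d'}$ for all $d,d'\in\mathcal D$. Then $\langle\,,\rangle:\mathcal H^{\mathcal D}\times\mathcal H^{\mathcal D}\to K$ is the unique pairing (bilinear form) such that: 1. for all $y\in\mathcal H^{\mathcal D}$, $\langle1,y\rangle=\varepsilon(y)$, where $\varepsilon$ is the counit of $\mathcal H^{\mathcal D}$; 2. for all $d\in\mathcal D$ and all $x,y\in\mathcal H^{\mathcal D}$, $\langle B_d^+(x),y\rangle=\langle x,\xi_d(y)\rangle$; 3. for all $x,y,z\in\mathcal H^{\mathcal D}$, $\langle xy,z\rangle=\langle x\otimes y,\Delta(z)\rangle$. Moreover, $\langle\,,\rangle$ is symmetric, homogeneous and non-degenerate, and for all $x,y\in\mathcal H^{\mathcal D}$, $\langle S(x),y\rangle=\langle x,S(y)\rangle$, where $S$ is the antipode of $\mathcal H^{\mathcal D}$.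
   Context: **Trees.** $\mathbb T^{\mathcal D}$ is the set of planar rooted trees with vertices decorated by $\mathcal D$; $\mathbb F^{\mathcal D}$ the set of planar forests (finite, possibly empty, ordered sequences of such trees; empty forest $1$). $\mathcal H^{\mathcal D}$ is the free associative unital $K$-algebra on $\mathbb T^{\mathcal D}$, with basis $\mathbb F^{\mathcal D}$ and product concatenation. $\bullet_d$ is the one-vertex tree decorated by $d$; $B_d^+:\mathcal H^{\mathcal D}\to\mathcal H^{\mathcal D}$ is the linear map grafting the trees of a forest (in order) on a common root decorated by $d$ (so $B_d^+(1)=\bullet_d$). An admissible cut $c$ of a tree $t$ is a nonempty set of edges such that every path from the root to a leaf meets at most one of them; $R^c(t)$ is the component of the root, $P^c(t)$ the planar forest of the other components (in the same order). One adds the empty cut ($P=1,R=t$) and the total cut ($P=t,R=1$), giving $\mathcal Adm_*(t)$. For $F=t_1\cdots t_n$, $\mathcal Adm_*(F)=\prod_i\mathcal Adm_*(t_i)$, $P^c(F)=\prod_iP^{c_i}(t_i)$, $R^c(F)=\prod_iR^{c_i}(t_i)$ (ordered products). $\mathcal H^{\mathcal D}$ is a Hopf algebra with coproduct $\Delta(F)=\sum_{c\in\mathcal Adm_*(F)}P^c(F)\otimes R^c(F)$ and counit $\varepsilon(F)=\delta_{F,1}$. If $|\cdot|:\mathcal D\to\mathbb N$ is a grading of $\mathcal D$, a forest has degree the sum of the degrees of the decorations of its vertices; homogeneous means $\langle x,y\rangle=0$ for homogeneous $x,y$ of different degrees. The linear map $\xi_d:\mathcal H^{\mathcal D}\to\mathcal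 H^{\mathcal D}$ is given on forests by: $\xi_d(1)=0$; for $F\ne1$, if the rightmost leaf of $F$ (the leaf reached from the root of the last tree of $F$ by always going to the rightmost child) is not decorated by $d$, then $\xi_d(F)=0$; if it is decorated by $d$, $\xi_d(F)$ is $F$ with this leaf removed. **Bidendriform structure on $\mathcal A^{\mathcal D}=\ker\varepsilon$.** A dendriform algebra is a vector space $A$ with $\prec,\succ:A\otimes A\to A$ such that $(a\prec b)\prec c=a\prec(b\prec c+b\succ c)$, $(a\succ b)\prec c=a\succ(b\prec c)$, $(a\prec b+a\succ b)\succ c=a\succ(b\succ c)$; $ab:=a\prec b+a\succ b$. A dendriform coalgebra is a vector space with $\Delta_\prec,\Delta_\succ$ such that, with $\tilde\Delta=\Delta_\prec+\Delta_\succ$: $(\Delta_\prec\otimes Id)\Delta_\prec=(Id\otimes\tilde\Delta)\Delta_\prec$, $(\Delta_\succ\otimes Id)\Delta_\prec=(Id\otimes\Delta_\prec)\Delta_\succ$, $(\tilde\Delta\otimes Id)\Delta_\succ=(Id\otimes\Delta_\succ)\Delta_\succ$. With $\Delta_\prec(a)=a'_\prec\otimes a''_\prec$, $\Delta_\succ(a)=a'_\succ\otimes a''_\succ$, $\tilde\Delta(a)=a'\otimes a''$ (sums implicit), a bidendriform bialgebra is both, with $\Delta_\succ(a\succ b)=a'b'_\succ\otimes a''\succ b''_\succ+a'\otimes a''\succ b+b'_\succ\otimes a\succ b''_\succ+ab'_\succ\otimes b''_\succ+a\otimes b$; $\Delta_\succ(a\prec b)=a'b'_\succ\otimes a''\prec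 b''_\succ+a'\otimes a''\prec b+b'_\succ\otimes a\prec b''_\succ$; $\Delta_\prec(a\succ b)=a'b'_\prec\otimes a''\succ b''_\prec+ab'_\prec\otimes b''_\prec+b'_\prec\otimes a\succ b''_\prec$; $\Delta_\prec(a\prec b)=a'b'_\prec\otimes a''\prec b''_\prec+a'b\otimes a''+b'_\prec\otimes a\prec b''_\prec+b\otimes a$. $\mathcal A^{\mathcal D}$ carries the unique dendriform algebra structure with $x\prec y+x\succ y=xy$ (concatenation) and $\bullet_d\prec x=B_d^+(x)$ for all $d$, $x$ (it is then free on the $\bullet_d$), and $\Delta_\prec,\Delta_\succ$ are the unique maps making it a bidendriform bialgebra with $(\Delta_\prec+\Delta_\succ)(x)=\Delta(x)-x\otimes1-1\otimes x$ and $\Delta_\prec(\bullet_d)=\Delta_\succ(\bullet_d)=0$. **Pairings.** A bilinear form $\langle\,,\rangle:A\times B\to K$ between bidendriform bialgebras is a bidendriform pairing if for $\ast\in\{\prec,\succ\}$: $\langle a_1\ast a_2,b\rangle=\langle a_1\otimes a_2,\Delta_\ast(b)\rangle$ and $\langle a,b_1\ast b_2\rangle=\langle\Delta_\ast(a),b_1\otimes b_2\rangle$, where $\langle a_1\otimes a_2,b_1\otimes b_2\rangle=\langle a_1,b_1\rangle\langle a_2,b_2\rangle$. There is a unique bidendriform pairing on $\mathcal A^{\mathcal D}$ with $\langle\bullet_d,\bullet_{d'}\rangle=\delta_{d,d'}$; it is extended to $\mathcal H^{\mathcal D}=K\oplus\mathcal A^{\mathcal D}$ by $\langle1,1\rangle=1$,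 $\langle1,x\rangle=\langle x,1\rangle=0$ for $x\in\mathcal A^{\mathcal D}$. *)

(* Defs.v *)
From HB Require Import structures.
From mathcomp Require Import all_boot all_order all_algebra.
From mathcomp Require Import finmap monalg.

Set Implicit Arguments.
Unset Strict Implicit.
Unset Printing Implicit Defensive.

Import GRing.Theory.
Local Open Scope ring_scope.

Reserved Notation "x \ox y" (at level 40, left associativity).

(* Tensor calculus on free modules.  A K-vector space with basis B is
   {malg K[B]}, and {malg K[B1]} (x) {malg K[B2]} is {malg K[B1 * B2]}.  The
   operators below act on basis vectors, so they are meant for linear
   (respectively bilinear) arguments. *)
Section Tensor.
Variable K : fieldType.

Definition linext (B : choiceType) (V : lmodType K) (f : B -> V)
    (x : {malg K[B]}) : V :=
  \sum_(b <- msupp x) x@_b *: f b.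

Definition tens (B1 B2 : choiceType) (x : {malg K[B1]}) (y : {malg K[B2]}) :
    {malg K[(B1 * B2)%type]} :=
  \sum_(a <- msupp x) \sum_(b <- msupp y) (x@_a * y@_b) *: << (a, b) >>.

Local Notation "x \ox y" := (tens x y) : ring_scope.

Definition tmap (B1 B2 C1 C2 : choiceType)
    (f : {malg K[B1]} -> {malg K[C1]}) (g : {malg K[B2]} -> {malg K[C2]}) :
    {malg K[(B1 * B2)%type]} -> {malg K[(C1 * C2)%type]} :=
  linext (fun p => f << p.1 >> \ox g << p.2 >>).

(* (x1 (x) x2, y1 (x) y2) |-> f x1 y1 (x) g x2 y2 *)
Definition tmap2 (B C E : choiceType)
    (f g : {malg K[B]} -> {malg K[C]} -> {malg K[E]})
    (x : {malg K[(B * B)%type]}) (y : {malg K[(C * C)%type]}) : {malg K[(E * E)%type]} :=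
  linext (fun p =>
    linext (fun q => f << p.1 >> << q.1 >> \ox g << p.2 >> << q.2 >>) y) x.

(* (x1 (x) x2, y1 (x) y2) |-> f x1 y1 * f x2 y2 *)
Definition tform (B C : choiceType) (f : {malg K[B]} -> {malg K[C]} -> K)
    (x : {malg K[(B * B)%type]}) (y : {malg K[(C * C)%type]}) : K :=
  \sum_(p <- msupp x) \sum_(q <- msupp y)
     x@_p * y@_q * (f << p.1 >> << q.1 >> * f << p.2 >> << q.2 >>).

(* (x (x) y) (x) z |-> x (x) (y (x) z) *)
Definition tassoc (B1 B2 B3 : choiceType) :
    {malg K[((B1 * B2) * B3)%type]} -> {malg K[(B1 * (B2 * B3))%type]} :=
  linext (fun p => << (p.1.1, (p.1.2, p.2)) >>).

Definition bilinear_form (U V : lmodType K) (f : U -> V -> K) : Prop :=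
  (forall y, scalar (fun x => f x y)) /\ (forall x, scalar (f x)).

End Tensor.

Notation "x \ox y" := (tens x y) : ring_scope.

Section Bidendriform.
Variable K : fieldType.

Record bidendriform (B : choiceType) := Bidendriform {
  prec : {bilinear {malg K[B]} -> {malg K[B]} -> {malg K[B]}};
  succ : {bilinear {malg K[B]} -> {malg K[B]} -> {malg K[B]}};
  coprec : {linear {malg K[B]} -> {malg K[(B * B)%type]}};
  cosucc : {linear {malg K[B]} -> {malg K[(B * B)%type]}};
  dmul := fun a b => prec a b + succ a b;
  codelta := fun a => coprec a + cosucc a;
  precA : forall a b c, prec (prec a b) c = prec a (dmul b c);
  succ_precA : forall a b c, prec (succ a b) c = succ a (prec b c);
  succA : forall a b c, succ (dmul a b) c = succ a (succ b c);
  coprecA : forall a,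
    tassoc (tmap coprec id (coprec a)) = tmap id codelta (coprec a);
  coprec_cosuccA : forall a,
    tassoc (tmap cosucc id (coprec a)) = tmap id coprec (cosucc a);
  cosuccA : forall a,
    tassoc (tmap codelta id (cosucc a)) = tmap id cosucc (cosucc a);
  cosucc_succ : forall a b,
    cosucc (succ a b) =
      tmap2 dmul succ (codelta a) (cosucc b)
      + tmap id (fun x => succ x b) (codelta a)
      + tmap id (succ a) (cosucc b)
      + tmap (dmul a) id (cosucc b)
      + a \ox b;
  cosucc_prec : forall a b,
    cosucc (prec a b) =
      tmap2 dmul prec (codelta a) (cosucc b)
      + tmap id (fun x => prec x b) (codelta a)
      + tmap id (prec a) (cosucc b);
  coprec_succ : forall a b,
    coprec (succ a b) =
      tmap2 dmul succ (codelta a) (coprec b)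
      + tmap (dmul a) id (coprec b)
      + tmap id (succ a) (coprec b);
  coprec_prec : forall a b,
    coprec (prec a b) =
      tmap2 dmul prec (codelta a) (coprec b)
      + tmap (fun x => dmul x b) id (codelta a)
      + tmap id (prec a) (coprec b)
      + b \ox a
}.

Record bidendriform_pairing (B C : choiceType)
    (A : bidendriform B) (A' : bidendriform C)
    (f : {malg K[B]} -> {malg K[C]} -> K) : Prop := BidendriformPairing {
  bpair_bilinear : bilinear_form f;
  bpair_precl : forall a1 a2 b,
    f (prec A a1 a2) b = tform f (a1 \ox a2) (coprec A' b);
  bpair_succl : forall a1 a2 b,
    f (succ A a1 a2) b = tform f (a1 \ox a2) (cosucc A' b);
  bpair_precr : forall a b1 b2,
    f a (prec A' b1 b2) = tform f (coprec A a) (b1 \ox b2);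
  bpair_succr : forall a b1 b2,
    f a (succ A' b1 b2) = tform f (cosucc A a) (b1 \ox b2)
}.

End Bidendriform.

Unset Elimination Schemes.
Inductive tree (D : Type) : Type := Node of D & seq (tree D).
Set Elimination Schemes.

Section TreeChoice.

Lemma tree_ind (D : Type) (P : tree D -> Prop) :
  (forall d ts, foldr (fun t Q => P t /\ Q) True ts -> P (Node d ts)) ->
  forall t, P t.
Proof.
move=> H; fix IH 1 => -[d ts]; apply: H.
by elim: ts => [|t ts IHs] //=; split.
Qed.

Fixpoint tree_encode (D : Type) (t : tree D) : GenTree.tree D :=
  let: Node d ts := t in
  GenTree.Node 0 (GenTree.Leaf d :: map (@tree_encode D) ts).

Fixpoint tree_decode (D : Type) (u : GenTree.tree D) : option (tree D) :=
  if u is GenTree.Node _ (GenTree.Leaf d :: us)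
  then Some (Node d (pmap (@tree_decode D) us)) else None.

Lemma tree_encodeK (D : Type) : pcancel (@tree_encode D) (@tree_decode D).
Proof.
elim=> d ts /= IH; congr (Some (Node d _)).
by elim: ts IH => //= t ts IHs [-> /IHs ->].
Qed.

HB.instance Definition _ (D : choiceType) :=
  Choice.copy (tree D) (pcan_type (@tree_encodeK D)).

End TreeChoice.

(* A planar forest is an element of the free monoid on trees; the empty forest
   is mone and concatenation is mmul.  HT K D is thus the free associative
   algebra on trees, and AT K D is spanned by the nonempty forests. *)
Notation forest D := {fmonom (tree D)}.

Definition neforest (D : choiceType) : choiceType :=
  {F : forest D | F != mone}.

Notation HT K D := {malg K[forest D]}.
Notation AT K D := {malg K[neforest D]}.

Section Trees.
Variable D : choiceType.
Implicit Types (t : tree D) (F : forest D).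

Definition seqprod (T : Type) (ss : seq (seq T)) : seq (seq T) :=
  foldr (fun s r => [seq x :: l | x <- s, l <- r]) [:: [::]] ss.

(* An admissible cut is a set of edges.  The edges of a tree are identified
   with its non-root vertices (the edge of v joins v to its parent), so a cut
   of t is a relabelling of t by D * bool, the boolean telling whether the edge
   above the vertex belongs to the cut.  The root has no edge above it: marking
   it encodes the total cut. *)
Fixpoint markings t : seq (tree (D * bool)) :=
  let: Node d ts := t in
  [seq Node (d, b) us | b <- [:: false; true], us <- seqprod (map markings ts)].

Fixpoint branches (T : Type) (t : tree T) : seq (seq T) :=
  let: Node a ts := t in
  if ts is [::] then [:: [:: a]]
  else [seq a :: p | p <- flatten (map (@branches T) ts)].

Definition admissible (m : tree (D * bool)) : bool :=
  all (fun p => (count snd p <= 1)%N) (branches m).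

Fixpoint unmark (m : tree (D * bool)) : tree D :=
  let: Node a ms := m in Node a.1 (map unmark ms).

(* On admissible markings: the components of t away from the root, from left
   to right, and the component of the root (empty for the total cut). *)
Fixpoint cutP (m : tree (D * bool)) : seq (tree D) :=
  let: Node a ms := m in
  if a.2 then [:: unmark m] else flatten (map cutP ms).

Fixpoint cutR (m : tree (D * bool)) : seq (tree D) :=
  let: Node a ms := m in
  if a.2 then [::] else [:: Node a.1 (flatten (map cutR ms))].

Definition adm F : seq (seq (tree (D * bool))) :=
  seqprod [seq [seq m <- markings t | admissible m] | t <- fmonom_val F].

Definition forestP (c : seq (tree (D * bool))) : forest D :=
  FMonom (flatten (map cutP c)).

Definition forestR (c : seq (tree (D * bool))) : forest D :=
  FMonom (flatten (map cutR c)).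

Fixpoint rightmost t : D :=
  let: Node d ts := t in last d (map rightmost ts).

Fixpoint prune t : seq (tree D) :=
  let: Node d ts := t in
  if ts is [::] then [::]
  else [:: Node d (take (size ts).-1 ts ++ last [::] (map prune ts))].

Definition forest_rightmost F : option D :=
  last None [seq Some (rightmost t) | t <- fmonom_val F].

Definition forest_prune F : forest D :=
  FMonom (take (size F).-1 F ++ last [::] (map prune F)).

Fixpoint tree_deg (deg : D -> nat) t : nat :=
  let: Node d ts := t in (deg d + sumn (map (tree_deg deg) ts))%N.

Definition forest_deg (deg : D -> nat) F : nat :=
  sumn (map (tree_deg deg) F).

End Trees.

Section HopfTrees.
Variables (K : fieldType) (D : choiceType).
Local Notation H := (HT K D).
Local Notation A := (AT K D).

Definition counit (x : H) : K := x@_mone.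

Definition coprod : H -> {malg K[(forest D * forest D)%type]} :=
  linext (fun F => \sum_(c <- adm F) << (forestP c, forestR c) >>).

Definition Bplus (d : D) : H -> H :=
  linext (fun F : forest D => << FMonom [:: Node d F] >>).

Definition xi (d : D) : H -> H :=
  linext (fun F : forest D =>
    if forest_rightmost F == Some d then << forest_prune F >> else 0).

Definition mulH : {malg K[(forest D * forest D)%type]} -> H :=
  linext (fun p => << p.1 >> * << p.2 >>).

Definition is_antipode (S : {linear H -> H}) : Prop :=
  forall x, mulH (tmap S id (coprod x)) = counit x *: 1
         /\ mulH (tmap id S (coprod x)) = counit x *: 1.

Definition inclA : A -> H := linext (fun F : neforest D => << val F >>).

(* projA is the projection along K 1; insub fails exactly on the empty forest. *)
Definition projA : H -> A :=
  linext (fun F : forest D => if insub F is Some G then << G >> else 0).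

Fact bullet_subproof (d : D) : FMonom [:: Node d [::]] != mone.
Proof. by rewrite fmP fm1. Qed.

Definition bullet (d : D) : A :=
  << (Sub (FMonom [:: Node d [::]]) (bullet_subproof d) : neforest D) >>.

Record tree_bidendriform (Ad : bidendriform K (neforest D)) : Prop :=
    TreeBidendriform {
  tree_dmul : forall x y,
    inclA (prec Ad x y + succ Ad x y) = inclA x * inclA y;
  tree_prec : forall d x, inclA (prec Ad (bullet d) x) = Bplus d (inclA x);
  tree_codelta : forall x,
    tmap inclA inclA (coprec Ad x + cosucc Ad x)
      = coprod (inclA x) - inclA x \ox 1 - 1 \ox inclA x;
  tree_coprec : forall d, coprec Ad (bullet d) = 0;
  tree_cosucc : forall d, cosucc Ad (bullet d) = 0
}.

(* Extension of a form on A to H = K 1 (+) A, the two summands orthogonal. *)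
Definition extend_form (f : A -> A -> K) (x y : H) : K :=
  counit x * counit y + f (projA x) (projA y).

Record inductive_pairing (g : H -> H -> K) : Prop := InductivePairing {
  ipair_unit : forall y, g 1 y = counit y;
  ipair_Bplus : forall d x y, g (Bplus d x) y = g x (xi d y);
  ipair_mul : forall x y z, g (x * y) z = tform g (x \ox y) (coprod z)
}.

Definition homogeneous_elt (deg : D -> nat) (n : nat) (x : H) : Prop :=
  forall F : forest D, F \in msupp x -> forest_deg deg F = n.

Definition form_symmetric (g : H -> H -> K) : Prop :=
  forall x y, g x y = g y x.

Definition form_homogeneous (deg : D -> nat) (g : H -> H -> K) : Prop :=
  forall m n x y, homogeneous_elt deg m x -> homogeneous_elt deg n y ->
    m <> n -> g x y = 0.

Definition form_nondegenerate (g : H -> H -> K) : Prop :=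
  (forall x, (forall y, g x y = 0) -> x = 0)
  /\ (forall y, (forall x, g x y = 0) -> y = 0).

End HopfTrees.

(* Main.v *)
From HB Require Import structures.
Require Import Defs.
From mathcomp Require Import all_boot all_order all_algebra.
From mathcomp Require Import finmap monalg.

Set Implicit Arguments.
Unset Strict Implicit.
Unset Printing Implicit Defensive.

Import GRing.Theory.
Local Open Scope ring_scope.

(** Write [a <| b] and [a |> b] for the two half products of the augmentation
ideal, [a ** b] for their sum, which is the concatenation of forests, and v_d
for the one-vertex tree decorated by d.

The three conditions.  Since both half coproducts of v_d vanish, v_d pairs to
zero with every product.  Contracting the left factor of the half coproduct
[coprec] with v_d therefore keeps only the terms of the compatibility axioms
whose left factor is not a product, and what remains obeys the same recursion,
along grafting and left concatenation, as pruning the rightmost leaf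
([xi_incl]).  As grafting on d is [v_d <| x], this is the second condition
([form_Bplus]); the third is the sum of the two half identities together with
the unit terms ([form_mul]).  The conditions determine the pairing with a
forest by induction on this forest ([inductive_pairing_unique]).  The
transposed form is another bidendriform pairing with the same values on
vertices, so it satisfies the conditions as well, whence symmetry.

Homogeneity.  Grafting and concatenation are graded, and the axioms express the
half products and half coproducts through them ([homog_prec],
[homog_coproducts]); then the pairing is graded because vertices generate.

Non-degeneracy.  Both half coproducts of an element of the radical lie in the
radical of the tensor square, so by induction on the number of vertices they
vanish.  Now a connected bidendriform bialgebra has a linear endomorphism that
fixes such total primitives and kills all half products ([rigidity]).  Vertices
generate, so the element is a combination of vertices, with coefficients its
pairings with the v_d, which are zero ([pair_radical]).  The endomorphism is a
composition of two projections onto invariants of Hopf modules, each defined by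
recursion on the weight.

Antipode.  The recursion [S x = - x - sum of S x' ** x''] on the augmentation
ideal turns both [<S x, y>] and [<x, S y>] into [- <x, y>] minus the sum of the
products of [<S x', y'>], respectively [<x', S y'>], with [<x'', y''>], so they
agree by induction ([pair_antipode_aug]). *)

(** * Linear algebra over free modules *)

(** Sealed, so that comparing two basis vectors only compares their indices
instead of unfolding finitely supported functions. *)
HB.lock Definition basis (K : fieldType) (B : choiceType) (b : B) :
  {malg K[B]} := << b >>.
Arguments basis {K B} b.

Notation "''b_' b" := (basis b) (at level 8, b at level 2, format "''b_' b").

(** The Sweedler sum of [phi u' u''] over the tensor [u]; every identity between
iterated coproducts below is an identity between such sums. *)
HB.lock Definition cap (K : fieldType) (B C : choiceType) (V : lmodType K)
    (phi : {malg K[B]} -> {malg K[C]} -> V) (u : {malg K[(B * C)%type]}) : V :=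
  linext (fun p => phi 'b_(p.1) 'b_(p.2)) u.
Arguments cap {K B C V} phi u.

Section Linear.
Variable K : fieldType.

Lemma basisE (B : choiceType) (b : B) : << b >> = 'b_b :> {malg K[B]}.
Proof. by rewrite basis.unlock. Qed.

Definition bilin (U V W : lmodType K) (phi : U -> V -> W) : Prop :=
  (forall y, linear (phi^~ y)) /\ (forall x, linear (phi x)).

Section Closure.
Variables U V W : lmodType K.
Implicit Types f g : U -> V.

Lemma lin_id : linear (@id U). Proof. by []. Qed.

Lemma lin_comp f (h : V -> W) : linear f -> linear h -> linear (fun x => h (f x)).
Proof. by move=> lf lh k x y; rewrite lf lh. Qed.

Lemma lin_add f g : linear f -> linear g -> linear (fun x => f x + g x).
Proof. by move=> lf lg k x y; rewrite lf lg scalerDr addrACA. Qed.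

Lemma lin_sub f g : linear f -> linear g -> linear (fun x => f x - g x).
Proof. by move=> lf lg k x y; rewrite lf lg scalerBr opprD addrACA. Qed.

Lemma lin0 f : linear f -> f 0 = 0.
Proof. by move=> lf; have := lf (-1) 0 0; rewrite scaleN1r oppr0 addr0 scaleN1r addNr. Qed.

Lemma linD f : linear f -> {morph f : x y / x + y}.
Proof. by move=> lf x y; rewrite -[x]scale1r lf !scale1r. Qed.

Lemma linZ f : linear f -> forall k, {morph f : x / k *: x}.
Proof. by move=> lf k x; rewrite -[k *: x]addr0 lf lin0 // addr0. Qed.

Lemma linB f : linear f -> {morph f : x y / x - y}.
Proof. by move=> lf x y; rewrite linD // -scaleN1r linZ // scaleN1r. Qed.

Lemma linN f : linear f -> {morph f : x / - x}.
Proof. by move=> lf x; rewrite -scaleN1r linZ // scaleN1r. Qed.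

Lemma lin_sum f (I : Type) (r : seq I) (E : I -> U) :
  linear f -> f (\sum_(i <- r) E i) = \sum_(i <- r) f (E i).
Proof. by move=> lf; apply: big_morph; [apply: linD | apply: lin0]. Qed.

Lemma lin_three f : linear f -> forall k l x y z,
  f (x + k *: y + l *: z) = f x + k *: f y + l *: f z.
Proof. by move=> lf *; rewrite !(linD lf) !(linZ lf). Qed.

Lemma lin_four f : linear f -> forall k l m n x y z w,
  f (k *: (l *: x) + m *: y + (n *: z + w)) =
    k *: (l *: f x) + m *: f y + (n *: f z + f w).
Proof. by move=> lf *; rewrite !(linD lf) !(linZ lf). Qed.

End Closure.

Lemma bilin_comp (U U' V V' W : lmodType K) (phi : U -> V -> W) f g :
  bilin phi -> linear f -> linear g ->
  bilin (fun (x : U') (y : V') => phi (f x) (g y)).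
Proof. by case=> pl pr lf lg; split=> z k x y /=; rewrite (lf, lg) (pl, pr). Qed.

Lemma bilin_swap (U V W : lmodType K) (phi : U -> V -> W) :
  bilin phi -> bilin (fun y x => phi x y).
Proof. by case. Qed.

Lemma bilin_post (U V W W' : lmodType K) (phi : U -> V -> W) (f : W -> W') :
  bilin phi -> linear f -> bilin (fun x y => f (phi x y)).
Proof. by case=> pl pr lf; split=> z k x y /=; rewrite (pl, pr) lf. Qed.

Lemma bilin_add (U V W : lmodType K) (phi psi : U -> V -> W) :
  bilin phi -> bilin psi -> bilin (fun x y => phi x y + psi x y).
Proof.
by case=> pl pr [ql qr]; split=> z; apply: lin_add; auto.
Qed.

Lemma bundled_bilin (U V W : lmodType K) (phi : {bilinear U -> V -> W}) :
  bilin phi.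
Proof. by split=> z k x y /=; rewrite (linearPl, linearPr). Qed.

Lemma linextE (B : choiceType) (V : lmodType K) (f : B -> V) (d : {fset B}) x :
  (msupp x `<=` d)%fset -> linext f x = \sum_(b <- d) x@_b *: f b.
Proof.
move=> le; rewrite /linext; apply: big_fset_incl => // b _ /mcoeff_outdom ->.
by rewrite scale0r.
Qed.

Lemma lin_linext (B : choiceType) (V : lmodType K) (f : B -> V) :
  linear (linext f).
Proof.
move=> k x y.
pose d := (msupp x `|` msupp y)%fset.
rewrite !(@linextE _ _ _ d) ?fsubsetUl ?fsubsetUr //.
  rewrite scaler_sumr -big_split /=; apply: eq_bigr => b _.
  by rewrite mcoeffD mcoeffZ scalerDl scalerA.
apply/fsubsetP => b /(fsubsetP (msuppD_le _ _)).
by rewrite !in_fsetU => /orP[/(fsubsetP (msuppZ_le _ _))|] ->; rewrite ?orbT.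
Qed.

Lemma linextU (B : choiceType) (V : lmodType K) (f : B -> V) b :
  linext f 'b_b = f b.
Proof. by rewrite basis.unlock /linext msuppU oner_eq0 big_seq_fset1 mcoeffUU scale1r. Qed.

Lemma malg_expand (B : choiceType) (x : {malg K[B]}) :
  x = \sum_(b <- msupp x) x@_b *: 'b_b.
Proof.
rewrite {1}[x]monalgE; apply: eq_bigr => b _; apply/malgP => c.
by rewrite mcoeffZ basis.unlock !mcoeffU mulr_natr.
Qed.

Lemma malg_ind (B : choiceType) (P : {malg K[B]} -> Prop) :
  P 0 -> (forall k x y, P x -> P y -> P (k *: x + y)) ->
  (forall b, P 'b_b) -> forall x, P x.
Proof.
move=> P0 PD PU x; rewrite [x]malg_expand.
by elim/big_rec: _ => // b y _ Py; apply: PD.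
Qed.

Lemma eq_linext (B : choiceType) (V : lmodType K) (f g : B -> V) x :
  {in msupp x, f =1 g} -> linext f x = linext g x.
Proof.
move=> e; rewrite /linext [LHS]big_seq [RHS]big_seq.
by apply: eq_bigr => b /e ->.
Qed.

Lemma linext_lin (B : choiceType) (V W : lmodType K) (f : B -> V) (h : V -> W) x :
  linear h -> h (linext f x) = linext (fun b => h (f b)) x.
Proof.
by move=> lh; rewrite /linext lin_sum //; apply: eq_bigr => b _; rewrite linZ.
Qed.

Lemma lin_basis (B : choiceType) (V : lmodType K) (f : {malg K[B]} -> V) x :
  linear f -> f x = linext (fun b => f 'b_b) x.
Proof. by move=> lf; rewrite {1}[x]malg_expand -(linext_lin _ _ lf). Qed.

Lemma lin_expand (B : choiceType) (V : lmodType K) (f : {malg K[B]} -> V) x :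
  linear f -> f x = \sum_(b <- msupp x) x@_b *: f 'b_b.
Proof. by move=> lf; rewrite (lin_basis _ lf). Qed.

Lemma lin_ext (B : choiceType) (V : lmodType K) (f g : {malg K[B]} -> V) :
  linear f -> linear g -> (forall b, f 'b_b = g 'b_b) -> f =1 g.
Proof.
move=> lf lg e x; rewrite (lin_basis _ lf) (lin_basis _ lg).
by apply: eq_linext => b _.
Qed.

Lemma bilin_ext (B C : choiceType) (V : lmodType K)
    (phi psi : {malg K[B]} -> {malg K[C]} -> V) :
  bilin phi -> bilin psi ->
  (forall b c, phi 'b_b 'b_c = psi 'b_b 'b_c) ->
  forall x y, phi x y = psi x y.
Proof.
move=> [pl pr] [ql qr] e x y.
apply: (lin_ext (f := phi^~ y) (g := psi^~ y)) => // b /=.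
by apply: lin_ext => // c.
Qed.

Lemma lin_linext_fun (B : choiceType) (U V : lmodType K) (f : U -> B -> V) x :
  (forall b, linear (f^~ b)) -> linear (fun u => linext (f u) x).
Proof.
move=> lf k u v; rewrite /linext scaler_sumr -big_split; apply: eq_bigr => b _.
by rewrite lf scalerDr !scalerA mulrC.
Qed.

Section Cap.
Variables B C : choiceType.
Local Notation MB := {malg K[B]}.
Local Notation MC := {malg K[C]}.
Local Notation MBC := {malg K[(B * C)%type]}.

Lemma lin_cap (V : lmodType K) (phi : MB -> MC -> V) : linear (cap phi).
Proof. by rewrite cap.unlock; apply: lin_linext. Qed.

Lemma capU (V : lmodType K) (phi : MB -> MC -> V) p :
  cap phi 'b_p = phi 'b_(p.1) 'b_(p.2).
Proof. by rewrite cap.unlock linextU. Qed.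

Lemma eq_cap (V : lmodType K) (phi psi : MB -> MC -> V) u :
  {in msupp u, forall p, phi 'b_(p.1) 'b_(p.2) = psi 'b_(p.1) 'b_(p.2)} ->
  cap phi u = cap psi u.
Proof. by rewrite cap.unlock; apply: eq_linext. Qed.

Lemma cap0 (V : lmodType K) (phi : MB -> MC -> V) u :
  {in msupp u, forall p, phi 'b_(p.1) 'b_(p.2) = 0} -> cap phi u = 0.
Proof.
move=> e; rewrite (@eq_cap _ _ (fun _ _ => 0)) // cap.unlock /linext big1 // => p _.
by rewrite scaler0.
Qed.

Lemma cap_lin (V W : lmodType K) (phi : MB -> MC -> V) (h : V -> W) u :
  linear h -> h (cap phi u) = cap (fun x y => h (phi x y)) u.
Proof. by rewrite cap.unlock; apply: linext_lin. Qed.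

Lemma capD (V : lmodType K) (phi psi : MB -> MC -> V) u :
  cap (fun x y => phi x y + psi x y) u = cap phi u + cap psi u.
Proof.
by rewrite cap.unlock /linext -big_split; apply: eq_bigr => p _; rewrite scalerDr.
Qed.

Lemma lin_cap_fun (U V : lmodType K) (phi : U -> MB -> MC -> V) u :
  (forall x y, linear (fun w => phi w x y)) -> linear (fun w => cap (phi w) u).
Proof. by move=> h; rewrite cap.unlock; apply: lin_linext_fun. Qed.

Lemma tens_cap (x : MB) (y : MC) :
  x \ox y = linext (fun b => linext (fun c => 'b_(b, c)) y) x.
Proof.
rewrite /tens /linext basis.unlock; apply: eq_bigr => b _.
by rewrite scaler_sumr; apply: eq_bigr => c _; rewrite scalerA.
Qed.

Lemma bilin_tens : bilin (@tens K B C).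
Proof.
split=> z k x y /=; rewrite !tens_cap ?lin_linext //.
apply: (@lin_linext_fun _ _ _ (fun w b => linext (fun c => 'b_(b, c)) w)).
by move=> b; apply: lin_linext.
Qed.

Lemma tensU b c : 'b_b \ox 'b_c = 'b_(b, c) :> MBC.
Proof. by rewrite tens_cap !linextU. Qed.

Lemma cap_tens (V : lmodType K) (phi : MB -> MC -> V) x y :
  bilin phi -> cap phi (x \ox y) = phi x y.
Proof.
move=> bp; apply: (bilin_ext (phi := fun x y => cap phi (x \ox y))) => //.
  by apply: bilin_post; [apply: bilin_tens | apply: lin_cap].
by move=> b c; rewrite tensU capU.
Qed.

Lemma cap_id u : cap (@tens K B C) u = u.
Proof.
apply: (lin_ext (lin_cap _) (@lin_id _)) => -[b c].
by rewrite capU tensU.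
Qed.

End Cap.

Lemma tmapE (B1 B2 C1 C2 : choiceType)
    (f : {malg K[B1]} -> {malg K[C1]}) (g : {malg K[B2]} -> {malg K[C2]}) u :
  tmap f g u = cap (fun x y => f x \ox g y) u.
Proof. by rewrite cap.unlock basis.unlock. Qed.

Lemma lin_tmap (B1 B2 C1 C2 : choiceType)
    (f : {malg K[B1]} -> {malg K[C1]}) (g : {malg K[B2]} -> {malg K[C2]}) :
  linear (tmap f g).
Proof. exact: lin_linext. Qed.

Lemma cap_tmap (B1 B2 C1 C2 : choiceType) (V : lmodType K)
    (f : {malg K[B1]} -> {malg K[C1]}) (g : {malg K[B2]} -> {malg K[C2]})
    (phi : {malg K[C1]} -> {malg K[C2]} -> V) u :
  bilin phi -> cap phi (tmap f g u) = cap (fun x y => phi (f x) (g y)) u.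
Proof.
move=> bp; rewrite tmapE cap_lin; last exact: lin_cap.
by apply: eq_cap => p _; rewrite cap_tens.
Qed.

Lemma cap_tmap_tens (B C : choiceType) (V : lmodType K)
    (phi : {malg K[B]} -> {malg K[C]} -> V) (h : {malg K[C]} -> {malg K[C]})
    b a u :
  bilin phi ->
  cap phi (tmap id h u + b \ox a) = cap (fun x y => phi x (h y)) u + phi b a.
Proof. by move=> bphi; rewrite (linD (lin_cap phi)) cap_tmap // cap_tens. Qed.

(** The shape of a coproduct that has been split into its reduced part and its
two unit terms; [e] plays the unit and [i] the inclusion of the augmentation
ideal. *)
Lemma cap_unital (B C : choiceType) (V : lmodType K)
    (phi : {malg K[C]} -> {malg K[C]} -> V) (i : {malg K[B]} -> {malg K[C]})
    k e c u :
  bilin phi ->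
  cap phi (k *: (e \ox e) + (tmap i i u + c \ox e + e \ox c)) =
    k *: phi e e + (cap (fun x y => phi (i x) (i y)) u + phi c e + phi e c).
Proof.
move=> bphi; rewrite (lin_cap phi) !(linD (lin_cap phi)).
by rewrite cap_tmap // !cap_tens.
Qed.

Lemma tmap2E (B C E : choiceType)
    (f g : {malg K[B]} -> {malg K[C]} -> {malg K[E]}) u v :
  tmap2 f g u v =
    cap (fun x y => cap (fun z w => f x z \ox g y w) v) u.
Proof. by rewrite cap.unlock basis.unlock. Qed.

Lemma cap_tmap2 (B C E : choiceType) (V : lmodType K)
    (f g : {malg K[B]} -> {malg K[C]} -> {malg K[E]})
    (phi : {malg K[E]} -> {malg K[E]} -> V) u v :
  bilin phi ->
  cap phi (tmap2 f g u v) =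
    cap (fun x y => cap (fun z w => phi (f x z) (g y w)) v) u.
Proof.
move=> bp; rewrite tmap2E cap_lin; last exact: lin_cap.
apply: eq_cap => p _; rewrite cap_lin; last exact: lin_cap.
by apply: eq_cap => q _; rewrite cap_tens.
Qed.

Lemma cap_tassoc (B1 B2 B3 : choiceType) (V : lmodType K)
    (T : {malg K[B1]} -> {malg K[B2]} -> {malg K[B3]} -> V) u :
  cap (fun x w => cap (T x) w) (tassoc u) =
  cap (fun w z => cap (fun x y => T x y z) w) u.
Proof.
apply: (lin_ext (f := fun u => cap (fun x w => cap (T x) w) (tassoc u))).
- by apply: lin_comp; [apply: lin_linext | apply: lin_cap].
- exact: lin_cap.
by move=> [[a b] c]; rewrite capU /tassoc linextU basisE /= !capU.
Qed.

Lemma cap_swap (B C B' C' : choiceType) (V : lmodType K)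
    (T : {malg K[B]} -> {malg K[C]} -> {malg K[B']} -> {malg K[C']} -> V) u v :
  cap (fun x y => cap (T x y) v) u =
  cap (fun z w => cap (fun x y => T x y z w) u) v.
Proof.
rewrite cap.unlock /linext.
under eq_bigr do rewrite scaler_sumr.
rewrite exchange_big; apply: eq_bigr => p _.
rewrite scaler_sumr; apply: eq_bigr => q _.
by rewrite !scalerA mulrC.
Qed.

Lemma tformE (B C : choiceType) (f : {malg K[B]} -> {malg K[C]} -> K) u v :
  tform f u v =
    cap (fun x y => cap (fun z w => (f x z * f y w : K^o)) v) u.
Proof.
rewrite /tform cap.unlock /linext basis.unlock; apply: eq_bigr => p _.
by rewrite scaler_sumr; apply: eq_bigr => q _; rewrite scalerA.
Qed.

End Linear.

(** * Rigidity of connected bidendriform bialgebras *)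

Section WeightRecursion.
Variables (K : fieldType) (B : choiceType) (V : lmodType K) (w : B -> nat).

(** If [Phi P] on a basis vector only sees [P] on lighter ones, then the iterates
of [Phi] are eventually constant on each basis vector. *)
Lemma weight_recursion (Phi : ({malg K[B]} -> V) -> {malg K[B]} -> V) :
  (forall P, linear P -> linear (Phi P)) ->
  (forall P Q b, (forall c, (w c < w b)%N -> P 'b_c = Q 'b_c) ->
     Phi P 'b_b = Phi Q 'b_b) ->
  exists2 P, linear P & forall x, P x = Phi P x.
Proof.
move=> lPhi ePhi.
pose P_ n := iter n Phi (fun=> 0).
have stable n m b : (w b < n)%N -> (w b < m)%N -> P_ n 'b_b = P_ m 'b_b.
  elim: n m b => // n IH [|m] b //= bn bm.
  by apply: ePhi => c cb; apply: IH; apply: leq_trans cb _.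
pose P := linext (fun b => P_ (w b).+1 'b_b).
have lP : linear P by apply: lin_linext.
exists P => //; apply: lin_ext => //; first exact: lPhi.
move=> b; rewrite /P linextU /=; apply: ePhi => c cb.
by rewrite linextU; apply: (stable (w b) (w c).+1).
Qed.

End WeightRecursion.

Section Rigidity.
Variables (K : fieldType) (B : choiceType) (A : bidendriform K B).
Local Notation M := {malg K[B]}.
Local Notation "a <| b" := (prec A a b) (at level 40).
Local Notation "a |> b" := (succ A a b) (at level 40).
Local Notation "a ** b" := (dmul A a b) (at level 40).

Lemma bilin_prec : bilin (prec A). Proof. exact: bundled_bilin. Qed.
Lemma bilin_succ : bilin (succ A). Proof. exact: bundled_bilin. Qed.
Lemma bilin_dmul : bilin (dmul A).
Proof. by apply: bilin_add; [apply: bilin_prec | apply: bilin_succ]. Qed.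

Lemma lin_coprec : linear (coprec A). Proof. exact: linearP. Qed.
Lemma lin_cosucc : linear (cosucc A). Proof. exact: linearP. Qed.
Lemma dmulA a b c : (a ** b) ** c = a ** (b ** c).
Proof.
rewrite {1}/dmul succA {1}/dmul linearDl precA succ_precA.
by rewrite [RHS]/dmul -addrA -linearDr.
Qed.

Lemma coprec_dmul a b :
  coprec A (a ** b) =
    tmap2 (dmul A) (dmul A) (codelta A a) (coprec A b)
    + tmap (fun x => x ** b) id (codelta A a)
    + tmap (dmul A a) id (coprec A b)
    + tmap id (dmul A a) (coprec A b)
    + b \ox a.
Proof.
rewrite [a ** b]/dmul linearD coprec_prec coprec_succ.
have -> : tmap2 (dmul A) (dmul A) (codelta A a) (coprec A b) =
    tmap2 (dmul A) (prec A) (codelta A a) (coprec A b)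
    + tmap2 (dmul A) (succ A) (codelta A a) (coprec A b).
  rewrite !tmap2E -capD; apply: eq_cap => p _; rewrite -capD.
  by apply: eq_cap => q _; rewrite (linD ((bilin_tens _ _ _).2 _)).
have -> : tmap id (dmul A a) (coprec A b) =
    tmap id (prec A a) (coprec A b) + tmap id (succ A a) (coprec A b).
  rewrite !tmapE -capD; apply: eq_cap => p _.
  by rewrite (linD ((bilin_tens _ _ _).2 _)).
have perm (V : zmodType) (t1 t2 t3 t4 s1 s2 s3 : V) :
    (t1 + t2 + t3 + t4) + (s1 + s2 + s3) = t1 + s1 + t2 + s2 + (t3 + s3) + t4.
  by rewrite !addrA [LHS](ACl (1*5*2*6*3*7*4)).
exact: perm.
Qed.

Lemma cap_coprec_dmul (V : lmodType K) (phi : M -> M -> V) a b : bilin phi ->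
  cap phi (coprec A (a ** b)) =
    cap (fun x y => cap (fun z t => phi (x ** z) (y ** t)) (coprec A b))
      (codelta A a)
    + cap (fun x y => phi (x ** b) y) (codelta A a)
    + cap (fun z t => phi (a ** z) t) (coprec A b)
    + cap (fun z t => phi z (a ** t)) (coprec A b)
    + phi b a.
Proof.
move=> bphi; rewrite coprec_dmul !(linD (lin_cap phi)).
congr (_ + _ + _ + _ + _).
- exact: cap_tmap2.
- exact: cap_tmap.
- exact: cap_tmap.
- exact: cap_tmap.
exact: cap_tens.
Qed.

Lemma cap_cosucc_succ (V : lmodType K) (phi : M -> M -> V) a b : bilin phi ->
  cap phi (cosucc A (a |> b)) =
    cap (fun x y => cap (fun z t => phi (x ** z) (y |> t)) (cosucc A b))
      (codelta A a)
    + cap (fun x y => phi x (y |> b)) (codelta A a)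
    + cap (fun z t => phi z (a |> t)) (cosucc A b)
    + cap (fun z t => phi (a ** z) t) (cosucc A b)
    + phi a b.
Proof.
move=> bphi; rewrite cosucc_succ !(linD (lin_cap phi)).
congr (_ + _ + _ + _ + _).
- exact: cap_tmap2.
- exact: cap_tmap.
- exact: cap_tmap.
- exact: cap_tmap.
exact: cap_tens.
Qed.

(** Connectedness: both half coproducts strictly lower a weight on the basis. *)
Variable w : B -> nat.
Hypothesis coprec_lt : forall b p, p \in msupp (coprec A 'b_b) ->
  (w p.1 < w b)%N && (w p.2 < w b)%N.
Hypothesis cosucc_lt : forall b p, p \in msupp (cosucc A 'b_b) ->
  (w p.1 < w b)%N && (w p.2 < w b)%N.

Lemma codelta_lt b p : p \in msupp (codelta A 'b_b) ->
  (w p.1 < w b)%N && (w p.2 < w b)%N.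
Proof.
move=> /(fsubsetP (msuppD_le _ _)); rewrite in_fsetU.
by case/orP => [/coprec_lt|/cosucc_lt].
Qed.

(** Full multiplication on the left and [coprec A] make the space a Hopf module,
with invariants the kernel of [coprec A]; [P] is the projection onto them along
the products.  Solving [x = P x + sum of x'' ** P x'] for [P] avoids the
antipode. *)
Lemma coprec_projection :
  exists2 P : M -> M, linear P &
    forall x, P x = x - cap (fun u v => v ** P u) (coprec A x).
Proof.
apply: (@weight_recursion _ _ _ w (fun P x =>
  x - cap (fun u v => v ** P u) (coprec A x))) => [P lP|P Q b e].
  apply: lin_sub => //; apply: lin_comp; first exact: lin_coprec.
  exact: lin_cap.
congr (_ - _); apply: eq_cap => p /coprec_lt /andP[lt1 _].
by rewrite e.
Qed.

(** The same for the Hopf module given by [|>] and [cosucc A]. *)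
Lemma cosucc_projection :
  exists2 R : M -> M, linear R &
    forall x, R x = x - cap (fun u v => u |> R v) (cosucc A x).
Proof.
apply: (@weight_recursion _ _ _ w (fun R x =>
  x - cap (fun u v => u |> R v) (cosucc A x))) => [R lR|R Q b e].
  apply: lin_sub => //; apply: lin_comp; first exact: lin_cosucc.
  exact: lin_cap.
congr (_ - _); apply: eq_cap => p /cosucc_lt /andP[_ lt2].
by rewrite e.
Qed.

Section Projections.
Variables P R : M -> M.
Hypotheses (lP : linear P) (lR : linear R).
Hypothesis PE : forall x, P x = x - cap (fun u v => v ** P u) (coprec A x).
Hypothesis RE : forall x, R x = x - cap (fun u v => u |> R v) (cosucc A x).

Let lmr a : linear (dmul A a). Proof. exact: bilin_dmul.2. Qed.
Let lsr a : linear (succ A a). Proof. exact: bilin_succ.2. Qed.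

Let bP : bilin (fun u v => v ** P u).
Proof. exact: (bilin_swap (bilin_comp bilin_dmul (@lin_id _ _) lP)). Qed.
Let bR : bilin (fun u v => u |> R v).
Proof. exact: (bilin_comp bilin_succ (@lin_id _ _) lR). Qed.

(** Expanding [coprec A (a ** b)], the terms whose left factor is a product of
lighter elements vanish by induction, and what is left is [a] times the
recursion for [P b], that is [a ** b] itself. *)
Lemma coprec_projection_dmul a b : P (a ** b) = 0.
Proof.
suff {a b} H n i j : (w i + w j < n)%N -> P ('b_i ** 'b_j) = 0.
  apply: (bilin_ext (phi := fun a b => P (a ** b)) (psi := fun _ _ => 0)).
  - by apply: bilin_post => //; apply: bilin_dmul.
  - by split=> z k x y; rewrite scaler0 addr0.
  by move=> i j; apply: (H _ i j (leqnn _)).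
elim: n i j => // n IH i j; rewrite ltnS => le_n.
set a := 'b_i; set b := 'b_j.
rewrite PE (cap_coprec_dmul _ _ bP).
rewrite [X in X + _ + _ + _ + _]cap0 ?add0r => [|p /codelta_lt/andP[lt1 _]]; last first.
  apply: cap0 => q /coprec_lt/andP[lt2 _].
  rewrite (IH p.1 q.1) ?(lin0 (lmr _)) //.
  exact: leq_trans (leq_add lt1 (ltnW lt2)) le_n.
rewrite [X in X + _ + _ + _]cap0 ?add0r => [|p /codelta_lt/andP[lt1 _]]; last first.
  rewrite (IH p.1 j) ?(lin0 (lmr _)) //.
  by apply: leq_trans le_n; rewrite -addSn leq_add2r.
rewrite [X in X + _ + _]cap0 ?add0r => [|p /coprec_lt/andP[lt1 _]]; last first.
  rewrite (IH i p.1) ?(lin0 (lmr _)) //.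
  by apply: leq_trans le_n; rewrite -addnS leq_add2l.
rewrite (@eq_cap _ _ _ _ _ (fun u v => a ** (v ** P u))) => [|p _]; last exact: dmulA.
rewrite -(cap_lin (fun u v => v ** P u)) // -(linD (lmr a)).
by rewrite [P b]PE [cap _ _ + _]addrC subrK subrr.
Qed.

Lemma coprec_dmul_kernel a c : coprec A c = 0 ->
  coprec A (a ** c) = cap (fun x y => (x ** c) \ox y) (codelta A a) + c \ox a.
Proof.
move=> c0; rewrite coprec_dmul c0 !(lin0 (lin_tmap _ _)) !addr0 tmap2E tmapE.
rewrite [X in X + _ + _]cap0 ?add0r // => p _.
exact: (lin0 (lin_cap _)).
Qed.

Lemma coprec_succ_kernel a c : coprec A c = 0 -> coprec A (a |> c) = 0.
Proof.
move=> c0; rewrite coprec_succ c0 !(lin0 (lin_tmap _ _)) !addr0 tmap2E.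
by apply: cap0 => p _; apply: (lin0 (lin_cap _)).
Qed.

(** By induction the recursive terms [P x'] are already in the kernel, so that
[coprec A (x'' ** P x')] only involves [codelta A x'']; coassociativity turns
the resulting double sum back into the recursion for [P], and it telescopes to
[coprec A x]. *)
Lemma coprec_projection_kernel x : coprec A (P x) = 0.
Proof.
suff {x} H n i : (w i < n)%N -> coprec A (P 'b_i) = 0.
  apply: (lin_ext (f := fun x => coprec A (P x)) (g := fun=> 0)).
  - by apply: lin_comp => //; apply: lin_coprec.
  - by move=> k u v; rewrite scaler0 addr0.
  by move=> j /=; apply: (H _ j (leqnn _)).
elim: n i => // n IH i; rewrite ltnS => le_n.
set a := 'b_i.
rewrite PE (linB lin_coprec) cap_lin; last exact: lin_coprec.
rewrite (@eq_cap _ _ _ _ _ (fun u v =>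
  cap (fun y z => (y ** P u) \ox z) (codelta A v) + P u \ox v)); last first.
  move=> p /coprec_lt/andP[lt1 _]; apply: coprec_dmul_kernel.
  by apply: IH; apply: leq_trans lt1 le_n.
rewrite capD.
have -> : cap (fun u v => cap (fun y z => (y ** P u) \ox z) (codelta A v))
    (coprec A a) = cap (fun u v => (u - P u) \ox v) (coprec A a).
  transitivity (cap (fun u => cap (fun y z => (y ** P u) \ox z))
                  (tmap id (codelta A) (coprec A a))).
    rewrite cap_tmap //; split=> z k u v /=; last exact: lin_cap.
    apply: (lin_cap_fun (phi := fun u y z => (y ** P u) \ox z)) => y t.
    apply: (lin_comp (f := fun u => y ** P u) (h := fun s => s \ox t)).
      exact: lin_comp.
    exact: (bilin_tens _ _ _).1.
  rewrite -coprecA (cap_tassoc (fun u y z => (y ** P u) \ox z)) cap_tmap; last first.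
    split=> z k u v; first exact: lin_cap.
    apply: (lin_cap_fun (phi := fun z x y => (y ** P x) \ox z)) => ? ?.
    exact: (bilin_tens _ _ _).2.
  apply: eq_cap => p _.
  rewrite -(cap_lin (fun u v => v ** P u) (h := fun s => s \ox _)); last exact: (bilin_tens _ _ _).1.
  by rewrite [in RHS]PE opprB addrC subrK.
rewrite -capD (@eq_cap _ _ _ _ _ (@tens K B B)) ?cap_id ?subrr // => p _.
by rewrite -(linD ((bilin_tens _ _ _).1 _)) subrK.
Qed.

Lemma cosucc_projection_succ a b : R (a |> b) = 0.
Proof.
suff {a b} H n i j : (w i + w j < n)%N -> R ('b_i |> 'b_j) = 0.
  apply: (bilin_ext (phi := fun a b => R (a |> b)) (psi := fun _ _ => 0)).
  - by apply: bilin_post => //; apply: bilin_succ.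
  - by split=> z k x y; rewrite scaler0 addr0.
  by move=> i j; apply: (H _ i j (leqnn _)).
elim: n i j => // n IH i j; rewrite ltnS => le_n.
set a := 'b_i; set b := 'b_j.
rewrite RE (cap_cosucc_succ _ _ bR).
rewrite [X in X + _ + _ + _ + _]cap0 ?add0r => [|p /codelta_lt/andP[_ lt1]]; last first.
  apply: cap0 => q /cosucc_lt/andP[_ lt2].
  rewrite (IH p.2 q.2) ?(lin0 (lsr _)) //.
  exact: leq_trans (leq_add lt1 (ltnW lt2)) le_n.
rewrite [X in X + _ + _ + _]cap0 ?add0r => [|p /codelta_lt/andP[_ lt1]]; last first.
  rewrite (IH p.2 j) ?(lin0 (lsr _)) //.
  by apply: leq_trans le_n; rewrite -addSn leq_add2r.
rewrite [X in X + _ + _]cap0 ?add0r => [|p /cosucc_lt/andP[_ lt1]]; last first.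
  rewrite (IH i p.2) ?(lin0 (lsr _)) //.
  by apply: leq_trans le_n; rewrite -addnS leq_add2l.
rewrite (@eq_cap _ _ _ _ _ (fun u v => a |> (u |> R v))) => [|p _]; last exact: succA.
rewrite -(cap_lin (fun u v => u |> R v)) // -(linD (lsr a)).
by rewrite [R b]RE [cap _ _ + _]addrC subrK subrr.
Qed.

End Projections.

(** The projection is [R] after [P].  It kills [a ** b] because [P] does, and
[a |> c] for [c] in the kernel of [coprec A] because [P] fixes that element and
[R] kills it.  A general [b] is [P b] plus a sum of products [v ** c] with [c]
in that kernel, and [a |> (v ** c)] reduces to the two previous cases by the
dendriform axioms. *)
Lemma rigidity : exists Q : M -> M,
  [/\ linear Q,
      forall x, coprec A x = 0 -> cosucc A x = 0 -> Q x = x,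
      forall a b, Q (a <| b) = 0
    & forall a b, Q (a |> b) = 0].
Proof.
have [P lP PE] := coprec_projection.
have [R lR RE] := cosucc_projection.
have Qm a b : R (P (a ** b)) = 0.
  by rewrite coprec_projection_dmul // (lin0 lR).
have PK c : coprec A c = 0 -> P c = c.
  by move=> c0; rewrite PE c0 (lin0 (lin_cap _)) subr0.
have Qsk a c : coprec A c = 0 -> R (P (a |> c)) = 0.
  move=> c0; rewrite PK ?coprec_succ_kernel //.
  exact: cosucc_projection_succ.
have lQ : linear (fun x => R (P x)) by apply: lin_comp.
have Qsmk a v c : coprec A c = 0 -> R (P (a |> (v ** c))) = 0.
  move=> Cc.
  have -> : a |> (v ** c) = (a |> v) ** c - (a |> v) |> c + (a ** v) |> c.
    by rewrite [(a |> v) ** c]/dmul addrK [v ** c]/dmul linearDr -succ_precA -succA.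
  by rewrite (linD lQ) (linB lQ) Qm !Qsk // subr0 addr0.
have Qs a b : R (P (a |> b)) = 0.
  have -> : b = P b + cap (fun u v => v ** P u) (coprec A b) by rewrite PE subrK.
  rewrite linearDr (linD lQ) Qsk ?add0r; last exact: coprec_projection_kernel.
  rewrite cap_lin; last exact: bilin_succ.2.
  rewrite (cap_lin _ _ lQ); apply: cap0 => p _.
  by apply: Qsmk; apply: coprec_projection_kernel.
exists (fun x => R (P x)); split=> // [x Cx Sx|a b].
  by rewrite PK // RE Sx (lin0 (lin_cap _)) subr0.
by have := Qm a b; rewrite /dmul (linD lQ) Qs addr0.
Qed.

End Rigidity.

(** * Gradings *)

Section Homogeneous.
Variable K : fieldType.

Definition homog (B : choiceType) (w : B -> nat) (n : nat) (x : {malg K[B]}) :=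
  forall b, b \in msupp x -> w b = n.

Definition weight2 (B C : choiceType) (w : B -> nat) (w' : C -> nat) (p : B * C) :=
  (w p.1 + w' p.2)%N.

Section OneSpace.
Variables (B : choiceType) (w : B -> nat).
Implicit Types (x y : {malg K[B]}) (n : nat).

Lemma homogU b : homog w (w b) 'b_b.
Proof. by rewrite basis.unlock => c /(fsubsetP msuppU_le); rewrite in_fset1 => /eqP ->. Qed.

Lemma homog0 n : homog w n (0 : {malg K[B]}).
Proof. by move=> b; rewrite msupp0. Qed.

Lemma homogD n x y : homog w n x -> homog w n y -> homog w n (x + y).
Proof.
move=> hx hy b /(fsubsetP (msuppD_le _ _)); rewrite in_fsetU.
by case/orP => [/hx|/hy].
Qed.

Lemma homogN n x : homog w n x -> homog w n (- x).
Proof. by move=> hx b; rewrite msuppN => /hx. Qed.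

Lemma homogZ n k x : homog w n x -> homog w n (k *: x).
Proof. by move=> hx b /(fsubsetP (msuppZ_le _ _)) /hx. Qed.

Lemma homog_lin (C : choiceType) (w' : C -> nat) m n
    (f : {malg K[C]} -> {malg K[B]}) (y : {malg K[C]}) :
  linear f -> (forall c, homog w (m + w' c) (f 'b_c)) ->
  homog w' n y -> homog w (m + n) (f y).
Proof.
move=> lf hf hy; rewrite (lin_expand y lf) big_seq.
elim/big_ind: _ => [|u v|c /hy <-]; [exact: homog0 | exact: homogD |].
exact: homogZ.
Qed.

End OneSpace.

Lemma homog_bilin (B C E : choiceType) (w : B -> nat) (w' : C -> nat)
    (v : E -> nat) m n (phi : {malg K[B]} -> {malg K[C]} -> {malg K[E]}) x y :
  bilin phi -> (forall b c, homog v (w b + w' c) (phi 'b_b 'b_c)) ->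
  homog w m x -> homog w' n y -> homog v (m + n) (phi x y).
Proof.
case=> pl pr hphi hx hy; apply: (homog_lin (pr x) _ hy) => c; rewrite addnC.
by apply: (homog_lin (pl _) _ hx) => b; rewrite addnC.
Qed.

Lemma homog_cap (B C E : choiceType) (w : B -> nat) (w' : C -> nat)
    (v : E -> nat) m n (phi : {malg K[B]} -> {malg K[C]} -> {malg K[E]}) u :
  (forall b c, homog v (m + (w b + w' c)) (phi 'b_b 'b_c)) ->
  homog (weight2 w w') n u -> homog v (m + n) (cap phi u).
Proof.
move=> hphi; apply: homog_lin; first exact: lin_cap.
by move=> [b c]; rewrite capU; apply: hphi.
Qed.

Lemma homog_tens (B C : choiceType) (w : B -> nat) (w' : C -> nat) m n
    (x : {malg K[B]}) (y : {malg K[C]}) :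
  homog w m x -> homog w' n y -> homog (weight2 w w') (m + n) (x \ox y).
Proof.
apply: homog_bilin => [|b c]; first exact: bilin_tens.
by rewrite tensU; apply: (@homogU _ (weight2 w w') (b, c)).
Qed.

End Homogeneous.

(** * The bidendriform bialgebra of planar forests *)

Section Forests.
Variable D : choiceType.

(** The same as [val], with the subtype structure kept out of the terms. *)
Definition nval (F : neforest D) : forest D := val F.

Lemma nval_inj : injective nval. Proof. exact: val_inj. Qed.

Lemma nvalP F : nval F != mone. Proof. exact: (valP F). Qed.

Lemma ntree_subproof (t : tree D) : FMonom [:: t] != mone.
Proof. by rewrite fmP fm1. Qed.

Definition ntree (t : tree D) : neforest D :=
  Sub (FMonom [:: t]) (ntree_subproof t).

Lemma ncat_subproof (F G : neforest D) : mmul (nval F) (nval G) != mone.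
Proof.
by apply/eqP => /unitm[eF _]; have := nvalP F; rewrite eF eqxx.
Qed.

Definition ncat (F G : neforest D) : neforest D :=
  Sub (mmul (nval F) (nval G)) (ncat_subproof F G).

Definition ngraft (d : D) (G : neforest D) : neforest D :=
  ntree (Node d (nval G)).

Lemma neforest_ind (P : neforest D -> Prop) :
  (forall d, P (ntree (Node d [::]))) ->
  (forall d G, P G -> P (ngraft d G)) ->
  (forall F G, P F -> P G -> P (ncat F G)) -> forall F, P F.
Proof.
move=> Pb Pg Pc.
have ne t (ts : seq (tree D)) : FMonom (t :: ts) != mone.
  by rewrite fmP fm1.
have Pseq (ts : seq (tree D)) :
    foldr (fun t Q => P (ntree t) /\ Q) True ts ->
    forall F : neforest D, nval F = FMonom ts -> P F.
  elim: ts => [_ F eF|t [|t' ts] IH].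
  - by have := nvalP F; rewrite eF fmP fm1.
  - by move=> /= [Pt _] F eF; have -> : F = ntree t by apply: nval_inj.
  move=> [Pt Pts] F eF.
  have -> : F = ncat (ntree t) (Sub (FMonom (t' :: ts)) (ne t' ts)).
    by apply: nval_inj; apply/eqP; rewrite eF fmP fmM.
  by apply: Pc => //; apply: IH.
have Ptree t : P (ntree t).
  elim/tree_ind: t => d [|t ts] IH //.
  have -> : ntree (Node d (t :: ts)) = ngraft d (Sub (FMonom (t :: ts)) (ne t ts)).
    by apply: nval_inj.
  by apply: Pg; apply: (Pseq (t :: ts)).
by move=> F; apply: (Pseq (nval F)); rewrite ?fmK //; elim: (fmonom_val _).
Qed.

Section Degree.
Variable deg : D -> nat.

Definition ndeg (F : neforest D) : nat := forest_deg deg (nval F).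

Lemma ndeg_bullet d : ndeg (ntree (Node d [::])) = deg d.
Proof. by rewrite /ndeg /forest_deg /= !addn0. Qed.

Lemma ndeg_ngraft d G : ndeg (ngraft d G) = (deg d + ndeg G)%N.
Proof. by rewrite /ndeg /forest_deg /= addn0. Qed.

Lemma ndeg_ncat F G : ndeg (ncat F G) = (ndeg F + ndeg G)%N.
Proof. by rewrite /ndeg /forest_deg fmM map_cat sumn_cat. Qed.

End Degree.
End Forests.

(** Sealed for the same reason as basis vectors. *)
HB.lock Definition incl (K : fieldType) (D : choiceType) (x : AT K D) : HT K D :=
  inclA x.
HB.lock Definition proj (K : fieldType) (D : choiceType) (x : HT K D) : AT K D :=
  projA x.
Arguments incl {K D} x.
Arguments proj {K D} x.

Section TreeBidendriform.
Variables (K : fieldType) (D : choiceType).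
Variables (Ad : bidendriform K (neforest D)) (hAd : tree_bidendriform Ad).
Local Notation A := (AT K D).
Local Notation H := (HT K D).

Lemma lin_incl : linear (@incl K D).
Proof. by rewrite incl.unlock; apply: lin_linext. Qed.
Lemma lin_proj : linear (@proj K D).
Proof. by rewrite proj.unlock; apply: lin_linext. Qed.

Lemma inclU F : incl 'b_F = 'b_(nval F) :> H.
Proof. by rewrite incl.unlock /inclA linextU basisE. Qed.

Lemma inclK : cancel (@incl K D) (@proj K D).
Proof.
apply: lin_ext => [|//|F]; first exact: lin_comp lin_incl lin_proj.
by rewrite inclU proj.unlock /projA linextU /nval valK basisE.
Qed.

Lemma bulletE (d : D) : bullet K d = 'b_(ntree (Node d [::])).
Proof. by rewrite -basisE; congr << _ >>; apply: val_inj. Qed.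

Lemma BplusU d (F : forest D) : Bplus d 'b_F = 'b_(FMonom [:: Node d F]) :> H.
Proof. by rewrite /Bplus linextU basisE. Qed.

Lemma incl_prec_bullet d x : incl (prec Ad (bullet K d) x) = Bplus d (incl x).
Proof. by rewrite incl.unlock; apply: tree_prec. Qed.

Lemma prec_bullet d G : prec Ad (bullet K d) 'b_G = 'b_(ngraft d G).
Proof.
by apply: (can_inj inclK); rewrite incl_prec_bullet !inclU BplusU.
Qed.

Lemma incl_dmul x y : incl (dmul Ad x y) = incl x * incl y.
Proof. by rewrite incl.unlock; apply: tree_dmul. Qed.

Lemma malgUM (M : monomType) (F G : M) :
  'b_F * 'b_G = 'b_(mmul F G) :> {malg K[M]}.
Proof. by rewrite basis.unlock malgM_def fgmulUU mulr1. Qed.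

Lemma dmulU F G : dmul Ad 'b_F 'b_G = 'b_(ncat F G).
Proof. by apply: (can_inj inclK); rewrite incl_dmul !inclU malgUM. Qed.

Lemma codelta_bullet d : codelta Ad (bullet K d) = 0.
Proof. by rewrite /codelta (tree_coprec hAd) (tree_cosucc hAd) addr0. Qed.

Lemma coprec_prec_bullet d x :
  coprec Ad (prec Ad (bullet K d) x) =
    tmap id (prec Ad (bullet K d)) (coprec Ad x) + x \ox bullet K d.
Proof.
rewrite coprec_prec codelta_bullet tmap2E (lin0 (lin_cap _)) add0r.
by rewrite (lin0 (lin_tmap (fun y => dmul Ad y x) id)) add0r.
Qed.

Lemma cosucc_prec_bullet d x :
  cosucc Ad (prec Ad (bullet K d) x) =
    tmap id (prec Ad (bullet K d)) (cosucc Ad x).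
Proof.
rewrite cosucc_prec codelta_bullet tmap2E (lin0 (lin_cap _)) add0r.
by rewrite (lin0 (lin_tmap id (fun y => prec Ad y x))) add0r.
Qed.

(** The decorated vertices generate: a tree is a vertex times, on the left half,
its forest of branches, and concatenation is a sum of half products. *)
Lemma dendriform_ind (P : A -> Prop) :
  (forall k x y, P x -> P y -> P (k *: x + y)) ->
  (forall d, P (bullet K d)) ->
  (forall x y, P x -> P y -> P (prec Ad x y)) ->
  (forall x y, P x -> P y -> P (succ Ad x y)) -> inhabited D -> forall x, P x.
Proof.
move=> PL Pb Pp Ps [d0] x.
have P0 : P 0 by rewrite -(addNr (bullet K d0)) -scaleN1r; apply: PL.
have PD y z : P y -> P z -> P (y + z) by move=> Py Pz; rewrite -[y]scale1r; apply: PL.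
elim/malg_ind: x => // F; elim/neforest_ind: F => [d|d G PG|F G PF PG].
- by rewrite -bulletE.
- by rewrite -prec_bullet; apply: Pp.
by rewrite -dmulU; apply: PD; [apply: Pp | apply: Ps].
Qed.

Section Graded.
Variable deg : D -> nat.
Local Notation w := (ndeg deg).
Local Notation w2 := (weight2 (ndeg deg) (ndeg deg)).

Lemma homog_dmul m n x y :
  homog w m x -> homog w n y -> homog w (m + n) (dmul Ad x y).
Proof.
apply: homog_bilin => [|F G]; first exact: bilin_dmul.
by rewrite dmulU -ndeg_ncat; apply: homogU.
Qed.

(** On a tree the left half product is a grafting, by the first dendriform axiom,
and on a concatenation it is computed from its two factors by
[(a ** b) <| c = a ** (b <| c) + a <| (b ** c - b <| c)]. *)
Lemma homog_prec m n x y :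
  homog w m x -> homog w n y -> homog w (m + n) (prec Ad x y).
Proof.
move=> hx hy; suff {m x hx} H F : homog w (w F + n) (prec Ad 'b_F y).
  rewrite addnC; apply: (homog_lin ((bilin_prec Ad).1 y) _ hx) => F.
  by rewrite addnC; apply: H.
elim/neforest_ind: F n y hy => [d|d G _|F G IHF IHG] n y hy.
- rewrite ndeg_bullet; apply: homog_lin hy => [|G]; first exact: (bilin_prec _).2.
  by rewrite -bulletE prec_bullet -ndeg_ngraft; apply: homogU.
- rewrite -prec_bullet precA ndeg_ngraft -addnA.
  apply: homog_lin (homog_dmul (@homogU _ _ _ G) hy) => [|E].
    exact: (bilin_prec _).2.
  by rewrite prec_bullet -ndeg_ngraft; apply: homogU.
have -> : prec Ad 'b_(ncat F G) y =
    dmul Ad 'b_F (prec Ad 'b_G y)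
    + prec Ad 'b_F (dmul Ad 'b_G y - prec Ad 'b_G y).
  rewrite -dmulU [in LHS]/dmul linearDl precA succ_precA linearBr.
  by rewrite [dmul Ad 'b_F (prec _ _ _)]/dmul [RHS]addrC addrA subrK.
rewrite ndeg_ncat -addnA; apply: homogD.
  by apply: homog_dmul; [apply: homogU | apply: IHG].
apply: IHF; apply: homogD; first by apply: homog_dmul; first exact: homogU.
by apply: homogN; apply: IHG.
Qed.

Lemma homog_succ m n x y :
  homog w m x -> homog w n y -> homog w (m + n) (succ Ad x y).
Proof.
move=> hx hy; have -> : succ Ad x y = dmul Ad x y - prec Ad x y.
  by rewrite /dmul addrC addKr.
by apply: homogD; [apply: homog_dmul | apply: homogN; apply: homog_prec].
Qed.

Lemma homog_tmap m n a b (f g : A -> A) u :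
  (forall F, homog w (a + w F) (f 'b_F)) ->
  (forall F, homog w (b + w F) (g 'b_F)) ->
  homog w2 n u -> m = (a + b + n)%N -> homog w2 m (tmap f g u).
Proof.
move=> hf hg hu ->; rewrite tmapE; apply: homog_cap hu => F G.
by rewrite addnACA; apply: homog_tens.
Qed.

Lemma homog_tmap2 m n (f g : A -> A -> A) u v :
  (forall F G, homog w (w F + w G) (f 'b_F 'b_G)) ->
  (forall F G, homog w (w F + w G) (g 'b_F 'b_G)) ->
  homog w2 m u -> homog w2 n v -> homog w2 (m + n) (tmap2 f g u v).
Proof.
move=> hf hg hu hv; rewrite tmap2E addnC; apply: homog_cap hu => F G.
rewrite addnC; apply: homog_cap hv => F' G'.
by rewrite addnACA; apply: homog_tens.
Qed.

(** The compatibility axioms compute both half coproducts of a grafting and of a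
concatenation by graded operations, starting from zero on vertices. *)
Lemma homog_coproducts F :
  homog w2 (w F) (coprec Ad 'b_F) /\ homog w2 (w F) (cosucc Ad 'b_F).
Proof.
have hid a G : a = 0%N -> homog w (a + w G) (id 'b_G : A).
  by move=> ->; apply: homogU.
have hdm E G : homog w (w E + w G) (dmul Ad 'b_E 'b_G).
  by apply: homog_dmul; apply: homogU.
have hpr E G : homog w (w E + w G) (prec Ad 'b_E 'b_G).
  by apply: homog_prec; apply: homogU.
have hsu E G : homog w (w E + w G) (succ Ad 'b_E 'b_G).
  by apply: homog_succ; apply: homogU.
elim/neforest_ind: F => [d|d G [IHc IHs]|F G [IFc IFs] [IGc IGs]].
- by rewrite -bulletE (tree_coprec hAd) (tree_cosucc hAd); split; apply: homog0.
- have hg E : homog w (deg d + w E) (prec Ad (bullet K d) 'b_E).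
    by rewrite prec_bullet -ndeg_ngraft; apply: homogU.
  rewrite -prec_bullet coprec_prec_bullet cosucc_prec_bullet ndeg_ngraft.
  split; last by apply: (homog_tmap (a := 0)) IHs _ => //; auto.
  apply: homogD; first by apply: (homog_tmap (a := 0)) IHc _ => //; auto.
  rewrite addnC -(ndeg_bullet deg d) bulletE.
  by apply: homog_tens; apply: homogU.
have IFd : homog w2 (w F) (codelta Ad 'b_F) by apply: homogD.
have hr E : homog w (w G + w E) (dmul Ad 'b_E 'b_G) by rewrite addnC.
have hrp E : homog w (w G + w E) (prec Ad 'b_E 'b_G) by rewrite addnC.
have hrs E : homog w (w G + w E) (succ Ad 'b_E 'b_G) by rewrite addnC.
rewrite -dmulU [dmul _ _ _]/dmul !linearD coprec_prec coprec_succ cosucc_prec cosucc_succ.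
rewrite ndeg_ncat; split; do !apply: homogD;
  solve [ exact: homog_tmap2
        | by apply: (homog_tmap (a := 0)) IFd _ => //; auto; rewrite add0n addnC
        | by apply: (homog_tmap (b := 0)) IFd _ => //; auto; rewrite addn0 addnC
        | by apply: (homog_tmap (a := 0)) IGc _ => //; auto
        | by apply: (homog_tmap (a := 0)) IGs _ => //; auto
        | by apply: (homog_tmap (b := 0)) IGc _ => //; auto; rewrite addn0
        | by apply: (homog_tmap (b := 0)) IGs _ => //; auto; rewrite addn0
        | by apply: homog_tens; apply: homogU
        | by rewrite addnC; apply: homog_tens; apply: homogU ].
Qed.

Lemma homog_codelta F : homog w2 (w F) (codelta Ad 'b_F).
Proof. by have [] := homog_coproducts F; apply: homogD. Qed.

End Graded.
End TreeBidendriform.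

(** * Planar forests as a pointed algebra *)

Section PointedForests.
Variables (K : fieldType) (D : choiceType).
Local Notation A := (AT K D).
Local Notation H := (HT K D).

Lemma unit_basis : 1 = 'b_mone :> H.
Proof. by rewrite -basisE. Qed.

Lemma forest_cases (F : forest D) : F = mone \/ exists G : neforest D, F = nval G.
Proof.
have [->|nF] := eqVneq F mone; first by left.
by right; exists (Sub F nF).
Qed.

Lemma lin_counit : linear (@counit K D : H -> K^o).
Proof. by move=> k x y; rewrite /counit mcoeffD mcoeffZ. Qed.

Lemma counit_basis (F : forest D) : counit 'b_F = (F == mone)%:R :> K.
Proof. by rewrite /counit basis.unlock mcoeffU. Qed.

Lemma counit1 : counit (1 : H) = 1.
Proof. by rewrite unit_basis counit_basis eqxx. Qed.

Lemma counitM (x y : H) : counit (x * y) = counit x * counit y.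
Proof. exact: (rmorphM (@mcoeff (forest D) K mone)). Qed.

Lemma malg_scalerAr k (x y : H) : x * (k *: y) = k *: (x * y).
Proof.
apply/malgP => F; rewrite [RHS]mcoeffZ.
rewrite [LHS](@mcoeffMlw _ _ (msupp x) (msupp y)) ?msuppZ_le //.
rewrite [X in _ = _ * X](@mcoeffMlw _ _ (msupp x) (msupp y)) // mulr_sumr.
apply: eq_bigr => G _; rewrite mulr_sumr.
by apply: eq_bigr => E _; rewrite mcoeffZ mulrCA mulrnAr.
Qed.

Lemma lin_coprod : linear (@coprod K D). Proof. exact: lin_linext. Qed.

Lemma proj1 : proj (1 : H) = 0 :> A.
Proof. by rewrite unit_basis proj.unlock /projA linextU insubF // eqxx. Qed.

Lemma counit_incl (a : A) : counit (incl a) = 0.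
Proof.
apply: (lin_ext (V := K^o) (f := fun a : A => counit (incl a)) (g := fun=> 0)).
- by apply: lin_comp; [apply: lin_incl | apply: lin_counit].
- by move=> k x y; rewrite scaler0 addr0.
by move=> F; rewrite inclU counit_basis (negbTE (nvalP F)).
Qed.

Lemma incl_proj (x : H) : x = counit x *: 1 + incl (proj x).
Proof.
apply: (lin_ext (f := id) (g := fun x : H => counit x *: 1 + incl (proj x))) => //.
  apply: lin_add; last by apply: lin_comp; [apply: lin_proj | apply: lin_incl].
  by move=> k y z; rewrite (lin_counit k) scalerDl scalerA.
move=> F; have [->|[G ->]] := forest_cases F.
  by rewrite -unit_basis counit1 proj1 scale1r (lin0 (@lin_incl _ _)) addr0.
by rewrite -inclU inclK counit_incl scale0r add0r.
Qed.

End PointedForests.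

(** * Pruning the rightmost leaf *)

Section Pruning.
Variables (K : fieldType) (D : choiceType).
Local Notation A := (AT K D).
Local Notation H := (HT K D).

Lemma lin_xi d : linear (@xi K D d). Proof. exact: lin_linext. Qed.
Lemma lin_Bplus d : linear (@Bplus K D d). Proof. exact: lin_linext. Qed.

Lemma xiU d (F : forest D) :
  xi d 'b_F = if forest_rightmost F == Some d then 'b_(forest_prune F) else 0 :> H.
Proof. by rewrite /xi linextU; case: ifP => // _; rewrite basisE. Qed.

Lemma xi1 d : xi d (1 : H) = 0.
Proof. by rewrite unit_basis xiU /forest_rightmost fm1. Qed.

Lemma xi_bullet d (e : D) : xi d 'b_(nval (ntree (Node e [::]))) = (d == e)%:R *: 1 :> H.
Proof.
rewrite xiU /forest_rightmost /forest_prune /=.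
have -> : (Some e == Some d) = (d == e) by rewrite eq_sym.
case: eqP => _; rewrite ?scale0r // scale1r unit_basis.
by congr 'b_(_); apply/eqP; rewrite fmP fm1.
Qed.

Lemma nval_cons (G : neforest D) : exists t ts, nval G = FMonom (t :: ts).
Proof.
case: G => [[[|t ts]] nG]; last by exists t, ts.
by exfalso; move: nG; rewrite fmP fm1.
Qed.

Lemma last_some (T : Type) (x y : T) (o : option T) (s : seq T) :
  last o [seq Some z | z <- x :: s] = Some (last y (x :: s)).
Proof. by elim: s x => //= z s IH x; apply: (IH z). Qed.

Lemma xi_ngraft d e (G : neforest D) :
  xi d (Bplus e 'b_(nval G)) = Bplus e (xi d 'b_(nval G)) :> H.
Proof.
rewrite BplusU !xiU; have [t [ts ->]] := nval_cons G.
have -> : forest_rightmost (FMonom [:: Node e (t :: ts)]) =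
    forest_rightmost (FMonom (t :: ts)).
  rewrite /forest_rightmost /= -(last_some (rightmost t) e None).
  by rewrite /= -map_comp.
case: eqP => _; last by rewrite (lin0 (lin_Bplus e)).
by rewrite BplusU.
Qed.

Lemma xi_ncat d (F : forest D) (G : neforest D) :
  xi d ('b_(mmul F (nval G))) = 'b_F * xi d 'b_(nval G) :> H.
Proof.
rewrite !xiU; have [t [ts ->]] := nval_cons G.
have -> : forest_rightmost (mmul F (FMonom (t :: ts))) =
    forest_rightmost (FMonom (t :: ts)).
  by rewrite /forest_rightmost fmM map_cat last_cat.
case: eqP => _; last by rewrite mulr0.
rewrite malgUM; congr 'b_(_); apply/eqP; rewrite fmP /forest_prune fmM /= fmM /=.
rewrite size_cat /= addnS /= take_cat ltnNge leq_addr /= addKn.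
by rewrite map_cat last_cat catA.
Qed.

Lemma incl_bullet (Ad : bidendriform K (neforest D)) (hAd : tree_bidendriform Ad) d :
  incl (bullet K d) = Bplus d 1 :> H.
Proof.
rewrite bulletE inclU unit_basis BplusU; congr 'b_(_).
by apply/eqP; rewrite fmP /= fm1.
Qed.

End Pruning.

(** * Pairings *)


Section TensorForm.
Variables (K : fieldType) (B C : choiceType).
Variable g : {malg K[B]} -> {malg K[C]} -> K.
Hypothesis bg : bilinear_form g.

Lemma form_bilin : bilin (g : _ -> _ -> K^o). Proof. exact: bg. Qed.

Lemma lin_forml y : linear (g^~ y : _ -> K^o). Proof. exact: form_bilin.1. Qed.
Lemma lin_formr x : linear (g x : _ -> K^o). Proof. exact: form_bilin.2. Qed.

Lemma bilin_formM x y : bilin (fun z t => g x z * g y t : K^o).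
Proof.
split=> w k a b /=; rewrite lin_formr /= ?mulrDl ?mulrDr; congr (_ + _).
  exact/esym/mulrA.
exact: mulrCA.
Qed.

Lemma tform_tensl x y v :
  tform g (x \ox y) v = cap (fun z t => (g x z * g y t : K^o)) v.
Proof.
rewrite tformE (cap_tens (phi := fun x y =>
  cap (fun z t => (g x z * g y t : K^o)) v)) //; split=> u /=.
  apply: (lin_cap_fun (phi := fun w z t => (g w z * g u t : K^o))) => z t.
  by move=> k a b; rewrite lin_forml /= mulrDl; congr (_ + _); apply/esym/mulrA.
apply: (lin_cap_fun (phi := fun w z t => (g u z * g w t : K^o))) => z t.
by move=> k a b; rewrite lin_forml /= mulrDr; congr (_ + _); apply: mulrCA.
Qed.

Lemma tform_tensr u z t :
  tform g u (z \ox t) = cap (fun x y => (g x z * g y t : K^o)) u.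
Proof.
rewrite tformE; apply: (eq_cap (V := K^o)) => p _.
exact: (cap_tens _ _ (bilin_formM _ _)).
Qed.

Lemma transpose_bilinear : bilinear_form (fun y x => g x y).
Proof. by case: bg. Qed.

End TensorForm.

Lemma tform_transpose (K : fieldType) (B C : choiceType)
    (g : {malg K[B]} -> {malg K[C]} -> K) u v :
  tform (fun y x => g x y) v u = tform g u v.
Proof. by rewrite !tformE cap_swap. Qed.

Section TreePairing.
Variables (K : fieldType) (D : choiceType).
Local Notation A := (AT K D).
Local Notation H := (HT K D).
Variables (Ad : bidendriform K (neforest D)) (hAd : tree_bidendriform Ad).
Variable f : A -> A -> K.
Hypothesis hf : bidendriform_pairing Ad Ad f.
Hypothesis hf1 : forall d d', f (bullet K d) (bullet K d') = (d == d')%:R.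

Let bf : bilinear_form f. Proof. exact: bpair_bilinear hf. Qed.
Let lfl y : linear (f^~ y : _ -> K^o). Proof. exact: lin_forml. Qed.
Let lfr x : linear (f x : _ -> K^o). Proof. exact: lin_formr. Qed.

Lemma pairing_transpose : bidendriform_pairing Ad Ad (fun x y => f y x).
Proof.
split; first exact: transpose_bilinear.
- by move=> a b c; rewrite tform_transpose (bpair_precr hf).
- by move=> a b c; rewrite tform_transpose (bpair_succr hf).
- by move=> a b c; rewrite tform_transpose (bpair_precl hf).
by move=> a b c; rewrite tform_transpose (bpair_succl hf).
Qed.

Lemma pair_precl a b c :
  f (prec Ad a b) c = cap (fun x y => (f a x * f b y : K^o)) (coprec Ad c).
Proof. by rewrite (bpair_precl hf) tform_tensl. Qed.

Lemma pair_succl a b c :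
  f (succ Ad a b) c = cap (fun x y => (f a x * f b y : K^o)) (cosucc Ad c).
Proof. by rewrite (bpair_succl hf) tform_tensl. Qed.

Lemma pair_dmull a b c :
  f (dmul Ad a b) c = cap (fun x y => (f a x * f b y : K^o)) (codelta Ad c).
Proof.
by rewrite /dmul (linD (lfl c)) pair_precl pair_succl -(linD (lin_cap _)).
Qed.

Lemma pair_bullet_prec d a b : f (bullet K d) (prec Ad a b) = 0.
Proof.
by rewrite (bpair_precr hf) tform_tensr // (tree_coprec hAd) (lin0 (lin_cap _)).
Qed.

Lemma pair_bullet_succ d a b : f (bullet K d) (succ Ad a b) = 0.
Proof.
by rewrite (bpair_succr hf) tform_tensr // (tree_cosucc hAd) (lin0 (lin_cap _)).
Qed.

Lemma pair_bullet_dmul d a b : f (bullet K d) (dmul Ad a b) = 0.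
Proof.
by rewrite /dmul (linD (lfr _)) pair_bullet_prec pair_bullet_succ addr0.
Qed.

(** [f (bullet K d)] vanishes on half products, hence off degree [deg d]; since
vertices generate and the half coproducts are graded, the general case
follows. *)
Lemma pair_graded deg F G : ndeg deg F != ndeg deg G -> f 'b_F 'b_G = 0.
Proof.
have bullet_graded d F' : deg d != ndeg deg F' -> f (bullet K d) 'b_F' = 0.
  elim/neforest_ind: F' => [e|e G' _|F1 F2 _ _].
  - rewrite ndeg_bullet -bulletE hf1; case: (d =P e) => [->|//].
    by rewrite eqxx.
  - by rewrite -(prec_bullet hAd) pair_bullet_prec.
  by rewrite -(dmulU hAd) pair_bullet_dmul.
elim/neforest_ind: F G => [d|d F IH|F1 F2 IH1 IH2] G.
- by rewrite ndeg_bullet -bulletE; apply: bullet_graded.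
- rewrite ndeg_ngraft -(prec_bullet hAd) pair_precl => ne.
  apply: (cap0 (V := K^o)) => p /(homog_coproducts hAd deg G).1 e.
  have [e1|/bullet_graded ->] := eqVneq (deg d) (ndeg deg p.1); last by rewrite mul0r.
  by rewrite IH ?mulr0 //; apply: contra ne => /eqP ->; rewrite e1 -e.
rewrite ndeg_ncat -(dmulU hAd) pair_dmull => ne.
apply: (cap0 (V := K^o)) => p /(homog_codelta hAd) e.
have [e1|/IH1 ->] := eqVneq (ndeg deg F1) (ndeg deg p.1); last by rewrite mul0r.
by rewrite IH2 ?mulr0 //; apply: contra ne => /eqP ->; rewrite e1 -(e deg).
Qed.

Local Notation form := (extend_form f).

Lemma formE x y : form x y = counit x * counit y + f (proj x) (proj y).
Proof. by rewrite proj.unlock. Qed.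

Lemma form_bilinear : bilinear_form form.
Proof.
have bmul : bilin (fun a b : K^o => a * b : K^o).
  by split=> z k x y /=; rewrite ?mulrDl ?mulrDr; congr (_ + _);
    [apply/esym/mulrA | apply: mulrCA].
have bc := bilin_comp bmul (@lin_counit K D) (@lin_counit K D).
have bp := bilin_comp (form_bilin bf) (@lin_proj K D) (@lin_proj K D).
have := bilin_add bc bp; rewrite proj.unlock; apply.
Qed.

Lemma form_1l y : form 1 y = counit y.
Proof. by rewrite formE counit1 proj1 (lin0 (lfl _)) mul1r addr0. Qed.

Lemma form_1r x : form x 1 = counit x.
Proof. by rewrite formE counit1 proj1 (lin0 (lfr _)) mulr1 addr0. Qed.

Lemma form_inclr x b : form x (incl b) = f (proj x) b.
Proof. by rewrite formE counit_incl inclK mulr0 add0r. Qed.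

Lemma form_incll a y : form (incl a) y = f a (proj y).
Proof. by rewrite formE counit_incl inclK mul0r add0r. Qed.

Lemma coprod_incl c :
  coprod (incl c) =
    tmap (@incl K D) (@incl K D) (codelta Ad c) + incl c \ox 1 + 1 \ox incl c.
Proof.
have -> : tmap (@incl K D) (@incl K D) (codelta Ad c) =
    coprod (incl c) - incl c \ox 1 - 1 \ox incl c.
  by rewrite incl.unlock; apply: (tree_codelta hAd c).
by rewrite addrAC !subrK.
Qed.

(** The empty forest has exactly one cut, the empty family of cuts. *)
Lemma coprod1 : coprod (1 : H) = 1 \ox 1.
Proof.
rewrite unit_basis /coprod linextU /adm fm1 /= big_seq1 basisE tensU.
by congr 'b_(_, _); apply/eqP; rewrite fmP fm1.
Qed.

Lemma proj_mul (x y : H) :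
  proj (x * y) =
    dmul Ad (proj x) (proj y) + counit y *: proj x + counit x *: proj y.
Proof.
have -> : x * y = counit x *: (counit y *: 1) + counit x *: incl (proj y)
    + (counit y *: incl (proj x) + incl (dmul Ad (proj x) (proj y))).
  rewrite {1}[x]incl_proj {1}[y]incl_proj mulrDl !mulrDr (incl_dmul hAd).
  by rewrite -!scalerAl !malg_scalerAr !mul1r !mulr1.
rewrite (lin_four (@lin_proj K D)) proj1 !inclK.
by rewrite !scaler0 add0r addrC [_ + dmul _ _ _]addrC.
Qed.

(** On the augmentation ideal this is the sum of the identities for the two half
products; the terms of the coproduct with a unit factor account for the
components of [x] and [y] along the unit. *)
Lemma form_mul x y z : form (x * y) z = tform form (x \ox y) (coprod z).
Proof.
rewrite (tform_tensl form_bilinear) {1 2}[z]incl_proj.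
set c := proj z.
rewrite (@lin_coprod K D _ 1) coprod1 coprod_incl.
rewrite (cap_unital _ _ _ _ _ (bilin_formM form_bilinear x y)).
rewrite (lin_formr form_bilinear (x * y) _ 1); congr (_ + _).
  by rewrite !form_1r counitM.
rewrite (form_inclr (x * y)) proj_mul (lin_three (lfl c)) pair_dmull.
rewrite (form_1r x) (form_1r y) (form_inclr x) (form_inclr y).
rewrite [f (proj x) c * _]mulrC; congr (_ + _ + _).
by apply: (eq_cap (V := K^o)) => p _; rewrite (form_inclr x) (form_inclr y).
Qed.

(** Contracting the left factor of [coprec Ad b] with a vertex prunes the
rightmost leaf.  All terms of the compatibility axioms whose left factor is a
product are lost, so that both sides commute with grafting and with left
concatenation; the summand along the unit is the case where the whole of [b] is
the pruned leaf. *)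
Lemma xi_incl d b :
  xi d (incl b) =
    f (bullet K d) b *: 1
    + incl (cap (fun x y => f (bullet K d) x *: y) (coprec Ad b)).
Proof.
set phi := fun x y : A => f (bullet K d) x *: y.
have bphi : bilin phi.
  split=> z k x y; rewrite /phi; last by rewrite scalerDr !scalerA mulrC.
  by rewrite lfr scalerDl scalerA.
have lphi : linear (fun b => incl (cap phi (coprec Ad b))).
  apply: lin_comp (@lin_incl K D); apply: lin_comp; first exact: lin_coprec.
  exact: lin_cap.
apply: (lin_ext (f := fun b => xi d (incl b))
    (g := fun b => f (bullet K d) b *: 1 + incl (cap phi (coprec Ad b)))).
- by apply: lin_comp (@lin_xi K D d); apply: lin_incl.
- apply: lin_add => //.
  by move=> k x y; rewrite lfr scalerDl scalerA.
elim/neforest_ind => [e|e G IH|F G _ IH].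
- rewrite -bulletE hf1 (tree_coprec hAd) (lin0 (lin_cap phi)).
  by rewrite (lin0 (@lin_incl K D)) addr0 bulletE inclU xi_bullet.
- rewrite -(prec_bullet hAd) pair_bullet_prec scale0r add0r.
  rewrite (incl_prec_bullet hAd) inclU xi_ngraft -inclU IH.
  rewrite (lin_Bplus e) -(incl_bullet hAd) -(incl_prec_bullet hAd).
  rewrite (coprec_prec_bullet hAd) (cap_tmap_tens _ _ _ _ bphi).
  rewrite -(@lin_incl K D) addrC; congr (incl (_ + _)).
  rewrite cap_lin; last exact: (bilin_prec Ad).2.
  by apply: eq_cap => p _; rewrite (linZ ((bilin_prec Ad).2 _)).
rewrite -(dmulU hAd) pair_bullet_dmul scale0r add0r.
rewrite (incl_dmul hAd) !inclU malgUM xi_ncat -(inclU K G) IH.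
rewrite mulrDr malg_scalerAr mulr1 -(inclU K F) -(incl_dmul hAd).
rewrite (cap_coprec_dmul _ _ _ bphi).
rewrite [X in X + _ + _ + _ + _]cap0 ?add0r => [|p _]; last first.
  by apply: cap0 => q _; rewrite /phi pair_bullet_dmul scale0r.
rewrite [X in X + _ + _ + _]cap0 ?add0r => [|p _]; last first.
  by rewrite /phi pair_bullet_dmul scale0r.
rewrite [X in X + _ + _]cap0 ?add0r => [|p _]; last first.
  by rewrite /phi pair_bullet_dmul scale0r.
rewrite -(@lin_incl K D) addrC; congr (incl (_ + _)).
rewrite cap_lin; last exact: (bilin_dmul Ad).2.
by apply: eq_cap => p _; rewrite (linZ ((bilin_dmul Ad).2 _)).
Qed.

(** Grafting is left half multiplication by a vertex, whose adjoint for the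
pairing is the contraction of [xi_incl]. *)
Lemma form_Bplus d x y : form (Bplus d x) y = form x (xi d y).
Proof.
have -> : Bplus d x = incl (counit x *: bullet K d + prec Ad (bullet K d) (proj x)).
  rewrite (@lin_incl K D) (incl_bullet hAd) (incl_prec_bullet hAd) -(lin_Bplus d).
  by rewrite -incl_proj.
have -> : xi d y = xi d (incl (proj y)).
  by rewrite {1}[y]incl_proj (lin_xi d) xi1 scaler0 add0r.
set c := proj y; rewrite form_incll -/c xi_incl (lfl c) pair_precl.
rewrite (lin_formr form_bilinear x) (form_1r x) form_inclr.
rewrite (cap_lin _ _ (lfr (proj x))); congr (_ + _).
  exact: mulrC.
by apply: (eq_cap (V := K^o)) => p _; rewrite (linZ (lfr _)).
Qed.

Lemma form_inductive : inductive_pairing form.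
Proof. by split; [exact: form_1l | exact: form_Bplus | exact: form_mul]. Qed.

End TreePairing.

(** * Properties of the pairing *)

Section Uniqueness.
Variables (K : fieldType) (D : choiceType).
Variables (Ad : bidendriform K (neforest D)) (hAd : tree_bidendriform Ad).
Local Notation A := (AT K D).
Local Notation H := (HT K D).

(** The first argument is a forest, built from the empty one by grafting and
concatenation, and each of the three conditions reduces one of these cases. *)
Lemma inductive_pairing_unique (g g' : H -> H -> K) :
  bilinear_form g -> inductive_pairing g ->
  bilinear_form g' -> inductive_pairing g' -> forall x y, g x y = g' x y.
Proof.
move=> bg ig bg' ig' x y.
suff E (F : forest D) z : g 'b_F z = g' 'b_F z.
  by apply: (lin_ext (lin_forml bg y) (lin_forml bg' y)) => F; apply: E.
have g1 t : g 1 t = g' 1 t by rewrite !ipair_unit.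
have [->|[{}F ->]] := forest_cases F; first by rewrite -unit_basis.
elim/neforest_ind: F z => [d|d G IH|F G IHF IHG] z.
- by rewrite -(inclU K) -bulletE (incl_bullet hAd) !ipair_Bplus.
- by rewrite -(inclU K) -(prec_bullet hAd) (incl_prec_bullet hAd) inclU !ipair_Bplus.
rewrite -(inclU K) -(dmulU hAd) (incl_dmul hAd) !inclU !ipair_mul //.
rewrite (tform_tensl bg) (tform_tensl bg').
by apply: (eq_cap (V := K^o)) => p _; rewrite IHF IHG.
Qed.

End Uniqueness.

Section Properties.
Variables (K : fieldType) (D : choiceType).
Local Notation A := (AT K D).
Local Notation H := (HT K D).
Variables (Ad : bidendriform K (neforest D)) (hAd : tree_bidendriform Ad).
Variable f : A -> A -> K.
Hypothesis hf : bidendriform_pairing Ad Ad f.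
Hypothesis hf1 : forall d d', f (bullet K d) (bullet K d') = (d == d')%:R.
Local Notation form := (extend_form f).

Let bf : bilinear_form f. Proof. exact: bpair_bilinear hf. Qed.
Let lfl y : linear (f^~ y : _ -> K^o). Proof. exact: lin_forml. Qed.
Let lfr x : linear (f x : _ -> K^o). Proof. exact: lin_formr. Qed.

(** The transposed form is again a bidendriform pairing with the same values on
vertices, so the uniqueness of inductive pairings applies. *)
Lemma form_sym : form_symmetric form.
Proof.
have hfT1 d d' : (fun x y => f y x) (bullet K d) (bullet K d') = (d == d')%:R.
  by rewrite hf1 eq_sym.
have hfT := pairing_transpose hf.
move=> x y.
rewrite (inductive_pairing_unique hAd (form_bilinear hf)
  (form_inductive hAd hf hf1) (form_bilinear hfT) (form_inductive hAd hfT hfT1)).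
by rewrite /extend_form mulrC.
Qed.

Lemma pair_sym a b : f a b = f b a.
Proof.
by have := form_sym (incl a) (incl b); rewrite !form_incll !inclK.
Qed.

Lemma form_graded deg : form_homogeneous deg form.
Proof.
move=> m n x y hx hy mn; rewrite formE.
have cn (z : H) k : homogeneous_elt deg k z -> k != 0%N -> counit z = 0 :> K.
  move=> hz k0; apply: mcoeff_outdom; apply/negP => /hz.
  by rewrite /forest_deg fm1 /= => /eqP; rewrite eq_sym (negbTE k0).
have -> : counit x * counit y = 0.
  have [m0|m0] := eqVneq m 0%N; last by rewrite (cn x m) ?mul0r.
  rewrite (cn y n) ?mulr0 //; apply/eqP => n0; apply: mn.
  by rewrite m0 n0.
have hp (z : H) k : homogeneous_elt deg k z -> homog (ndeg deg) k (proj z).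
  move=> hz; rewrite (lin_expand z (@lin_proj K D)) big_seq.
  elim/big_ind: _ => [|u v|F /hz <-]; [exact: homog0 | exact: homogD |].
  apply: homogZ.
  have [->|[G ->]] := forest_cases F.
    by rewrite -unit_basis proj1; apply: homog0.
  by rewrite -(inclU K) inclK; apply: homogU.
rewrite add0r (lin_expand (proj x) (lfl _)) big_seq big1 // => F Fx.
rewrite (lin_expand (proj y) (lfr _)) big_seq big1 ?scaler0 // => G Gy.
rewrite (pair_graded hAd hf hf1 (deg := deg)) ?scaler0 //.
by rewrite (hp _ _ hx _ Fx) (hp _ _ hy _ Gy); apply/eqP.
Qed.

Local Notation size := (ndeg (fun=> 1%N)).

Lemma size_gt0 (F : neforest D) : (0 < size F)%N.
Proof.
elim/neforest_ind: F => [d|d G _|F G pF _].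
- by rewrite ndeg_bullet.
- by rewrite ndeg_ngraft.
by rewrite ndeg_ncat addn_gt0 pF.
Qed.

Lemma coprec_size F p : p \in msupp (coprec Ad 'b_F) ->
  (size p.1 < size F)%N && (size p.2 < size F)%N.
Proof.
move=> /(homog_coproducts hAd (fun=> 1%N) F).1 <-.
by rewrite -[X in (X < _)%N && _]addn0 ltn_add2l -[X in _ && (X < _)%N]add0n
  ltn_add2r !size_gt0.
Qed.

Lemma cosucc_size F p : p \in msupp (cosucc Ad 'b_F) ->
  (size p.1 < size F)%N && (size p.2 < size F)%N.
Proof.
move=> /(homog_coproducts hAd (fun=> 1%N) F).2 <-.
by rewrite -[X in (X < _)%N && _]addn0 ltn_add2l -[X in _ && (X < _)%N]add0n
  ltn_add2r !size_gt0.
Qed.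

Lemma pair_bullet d x : f (bullet K d) x = x@_(ntree (Node d [::])).
Proof.
apply: (lin_ext (V := K^o) (f := f (bullet K d))
  (g := fun x : A => x@_(ntree (Node d [::])))) => //.
  by move=> k u v; rewrite mcoeffD mcoeffZ.
elim/neforest_ind => [e|e G _|F G _ _].
- rewrite -bulletE hf1 bulletE basis.unlock mcoeffU mulrb eq_sym.
  have -> : (ntree (Node e [::]) == ntree (Node d [::])) = (e == d).
    by apply/eqP/eqP => [/(congr1 (@nval D))[]|->].
  by case: (e == d).
- rewrite -{1}(prec_bullet hAd) (pair_bullet_prec hAd hf) basis.unlock mcoeffU.
  case: eqP => [/(congr1 (@ndeg D (fun=> 1%N)))|//].
  by rewrite ndeg_ngraft ndeg_bullet; have := size_gt0 G; case: (size G).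
rewrite -{1}(dmulU hAd) (pair_bullet_dmul hAd hf) basis.unlock mcoeffU.
case: eqP => [/(congr1 (@ndeg D (fun=> 1%N)))|//].
rewrite ndeg_ncat ndeg_bullet; have := size_gt0 G; have := size_gt0 F.
by case: (size G) (size F) => [|n] [|m] //; rewrite addnS.
Qed.

(** The rigidity projection fixes a total primitive, and its image is spanned by
the vertices because they generate and all half products are killed. *)
Lemma total_primitive_support x F :
  coprec Ad x = 0 -> cosucc Ad x = 0 -> inhabited D ->
  (forall d, F <> ntree (Node d [::])) -> x@_F = 0.
Proof.
move=> Cx Sx hD nF.
have [Q [lQ Qid Qp Qs]] := rigidity coprec_size cosucc_size.
rewrite -(Qid x) //; elim/(dendriform_ind hAd): x {Cx Sx} => // [k y z Hy Hz|d|y z _ _|y z _ _].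
- by rewrite lQ mcoeffD mcoeffZ Hy Hz mulr0 addr0.
- rewrite Qid ?(tree_coprec hAd) ?(tree_cosucc hAd) //.
  rewrite bulletE basis.unlock mcoeffU.
  by case: eqP => // eF; case: (nF d).
- by rewrite Qp mcoeff0.
by rewrite Qs mcoeff0.
Qed.

(** If the radical meets the subspace [P] trivially, then the radical of the
tensor square meets [P] tensor [P] trivially: contract one factor at a time. *)
Lemma pair_tensor_radical (P : A -> Prop) (u : {malg K[(neforest D * neforest D)%type]}) :
  P 0 -> (forall k x y, P x -> P y -> P (k *: x + y)) ->
  (forall p, p \in msupp u -> P 'b_(p.1) /\ P 'b_(p.2)) ->
  (forall x, P x -> (forall a, f a x = 0) -> x = 0) ->
  (forall a b, cap (fun x y => (f a x * f b y : K^o)) u = 0) -> u = 0.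
Proof.
move=> P0 PL Pu Prad u0.
have Pcap (phi : A -> A -> A) :
    (forall p, p \in msupp u -> P (phi 'b_(p.1) 'b_(p.2))) -> P (cap phi u).
  move=> h; rewrite (lin_expand u (lin_cap phi)) big_seq.
  elim/big_ind: _ => [//|x y Px Py|p pu].
    by rewrite -[x]scale1r; apply: PL.
  by rewrite capU -[_ *: _]addr0; apply: PL => //; apply: h.
have PZ k x : P x -> P (k *: x) by move=> Px; rewrite -[_ *: _]addr0; apply: PL.
have left0 b : cap (fun x y => f b y *: x) u = 0.
  apply: Prad => [|a]; first by apply: Pcap => p /Pu[P1 _]; apply: PZ.
  rewrite (cap_lin _ _ (lfr a)) -[RHS](u0 a b).
  by apply: (eq_cap (V := K^o)) => p _; rewrite (linZ (lfr a)) mulrC.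
have right0 c : cap (fun x y : A => x@_c *: y) u = 0.
  apply: Prad => [|b]; first by apply: Pcap => p /Pu[_ P2]; apply: PZ.
  have lc : linear (fun x : A => x@_c : K^o) by move=> k x y; rewrite mcoeffD mcoeffZ.
  have := congr1 (mcoeff c) (left0 b); rewrite mcoeff0 (cap_lin _ _ lc) => <-.
  rewrite (cap_lin _ _ (lfr b)).
  by apply: (eq_cap (V := K^o)) => p _; rewrite (linZ (lfr b)) (linZ lc); apply: mulrC.
apply/malgP => -[c e]; rewrite mcoeff0.
have le : linear (fun x : A => x@_e : K^o) by move=> k x y; rewrite mcoeffD mcoeffZ.
have := congr1 (mcoeff e) (right0 c); rewrite mcoeff0 (cap_lin _ _ le) => <-.
apply: (lin_ext (V := K^o)
  (f := fun u : {malg K[(neforest D * neforest D)%type]} => u@_(c, e)))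
  => [k x y||[c' e']].
- by rewrite mcoeffD mcoeffZ.
- exact: lin_cap.
by rewrite capU mcoeffZ basis.unlock !mcoeffU -natrM mulnb.
Qed.

Lemma msupp_lin (B C : choiceType) (h : {malg K[B]} -> {malg K[C]}) x c :
  linear h -> c \in msupp (h x) -> exists2 b, b \in msupp x & c \in msupp (h 'b_b).
Proof.
move=> lh; rewrite (lin_expand x lh) big_seq.
elim/big_ind: _ => [|y z IHy IHz|b bx].
- by rewrite msupp0.
- by move/(fsubsetP (msuppD_le _ _)); rewrite in_fsetU => /orP[/IHy|/IHz].
by move/(fsubsetP (msuppZ_le _ _)) => cb; exists b.
Qed.

(** The half coproducts of a radical element are orthogonal to all tensors and
live in smaller sizes, so they vanish by induction.  A total primitive is a
combination of vertices, whose coefficients are pairings with vertices. *)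
Lemma pair_radical x : inhabited D -> (forall a, f a x = 0) -> x = 0.
Proof.
move=> hD.
pose bounded n (x : A) := forall F, F \in msupp x -> (size F < n)%N.
have bZ n k y z : bounded n y -> bounded n z -> bounded n (k *: y + z).
  move=> hy hz F /(fsubsetP (msuppD_le _ _)); rewrite in_fsetU.
  by case/orP => [/(fsubsetP (msuppZ_le _ _))/hy|/hz].
have b0 n : bounded n 0 by move=> F; rewrite msupp0.
suff rad n y : bounded n y -> (forall a, f a y = 0) -> y = 0.
  apply: (rad (\max_(F <- msupp x) size F).+1) => F Fx.
  by rewrite ltnS; apply: (leq_bigmax_seq (F := fun F => size F)).
elim: n y => [|n IH] {}x bx x0.
  by apply/malgP => F; rewrite mcoeff0; apply: mcoeff_outdom; apply/negP => /bx.
have bco (co : A -> {malg K[(neforest D * neforest D)%type]}) :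
    linear co ->
    (forall F p, p \in msupp (co 'b_F) ->
      (size p.1 < size F)%N && (size p.2 < size F)%N) ->
    forall p, p \in msupp (co x) -> bounded n 'b_(p.1) /\ bounded n 'b_(p.2).
  move=> lco hco p /(msupp_lin lco)[F Fx /hco/andP[p1 p2]].
  by split=> G /(@homogU K _ (ndeg (fun=> 1%N))) ->; [apply: leq_trans p1 _ | apply: leq_trans p2 _];
    apply: (bx _ Fx).
have Cx : coprec Ad x = 0.
  apply: (pair_tensor_radical (b0 n) (@bZ n)) IH _ => [|a b].
    by apply: bco coprec_size; apply: lin_coprec.
  by rewrite -(pair_precl hf).
have Sx : cosucc Ad x = 0.
  apply: (pair_tensor_radical (b0 n) (@bZ n)) IH _ => [|a b].
    by apply: bco cosucc_size; apply: lin_cosucc.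
  by rewrite -(pair_succl hf).
apply/malgP => F; rewrite mcoeff0.
elim/neforest_ind: F => [d|d G _|F G _ _].
- by rewrite -pair_bullet.
- apply: total_primitive_support => // e /(congr1 (@ndeg D (fun=> 1%N))).
  by rewrite ndeg_ngraft ndeg_bullet; have := size_gt0 G; case: (size G).
apply: total_primitive_support => // e /(congr1 (@ndeg D (fun=> 1%N))).
rewrite ndeg_ncat ndeg_bullet; have := size_gt0 G; have := size_gt0 F.
by case: (size G) (size F) => [|k] [|m] //; rewrite addnS.
Qed.

Lemma form_nondeg : inhabited D -> form_nondegenerate form.
Proof.
move=> hD; have rad x : (forall y, form y x = 0) -> x = 0.
  move=> hx; rewrite [x]incl_proj -(form_1l hf) hx scale0r add0r.
  rewrite (@pair_radical (proj x)) ?(lin0 (@lin_incl K D)) // => a.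
  by rewrite -form_incll.
by split=> [x hx|//]; apply: rad => y; rewrite form_sym.
Qed.

Section Antipode.
Variable S : H -> H.
Hypothesis lS : linear S.
Hypothesis hS : forall x, mulH (tmap S id (coprod x)) = counit x *: 1.

Lemma bilin_mulH : bilin (fun x y : H => x * y).
Proof.
split=> z k x y; first by rewrite mulrDl -scalerAl.
by rewrite mulrDr malg_scalerAr.
Qed.

Lemma mulH_tmap (g h : H -> H) u : mulH (tmap g h u) = cap (fun x y => g x * h y) u.
Proof.
have -> v : mulH v = cap (fun x y : H => x * y) v by rewrite cap.unlock basis.unlock.
exact: (cap_tmap _ _ _ bilin_mulH).
Qed.

(** The restriction of the antipode to the augmentation ideal. *)
Definition antipode_aug (a : A) : A := proj (S (incl a)).

Lemma lin_antipode_aug : linear antipode_aug.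
Proof.
by move=> k x y; rewrite /antipode_aug (@lin_incl K D) (lS k (incl x)) (@lin_proj K D).
Qed.

Lemma antipode1 : S 1 = 1.
Proof.
have := hS 1; rewrite (coprod1 K D) counit1 scale1r mulH_tmap.
by rewrite (cap_tens _ _ (bilin_comp bilin_mulH lS (@lin_id _ _))) mulr1.
Qed.

Lemma antipode_incl_rec a :
  S (incl a) = - incl a - cap (fun x y => S (incl x) * incl y) (codelta Ad a).
Proof.
have := hS (incl a).
have bm := bilin_comp bilin_mulH lS (@lin_id _ _).
rewrite (coprod_incl hAd) counit_incl scale0r mulH_tmap -[X in cap _ X]add0r.
rewrite -[X in cap _ (X + _)](scale0r (1 \ox 1)) (cap_unital _ _ _ _ _ bm).
rewrite scale0r add0r mulr1 antipode1 mul1r => /eqP.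
by rewrite addrAC addrC addr_eq0 opprD addrC => /eqP ->; rewrite addrC.
Qed.

Lemma antipode_incl a : S (incl a) = incl (antipode_aug a).
Proof.
rewrite [LHS]incl_proj -/(antipode_aug a) antipode_incl_rec.
have -> : counit (- incl a - cap (fun x y => S (incl x) * incl y) (codelta Ad a)) = 0 :> K.
  have lc := @lin_counit K D.
  rewrite (linB lc) (linN lc) (cap_lin _ _ lc).
  rewrite counit_incl oppr0 sub0r (cap0 (V := K^o)) ?oppr0 // => p _.
  by rewrite counitM counit_incl mulr0.
by rewrite scale0r add0r.
Qed.

Lemma antipode_aug_rec a :
  antipode_aug a =
    - a - cap (fun x y => dmul Ad (antipode_aug x) y) (codelta Ad a).
Proof.
apply: (can_inj (@inclK K D)); rewrite -antipode_incl antipode_incl_rec.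
rewrite (linB (@lin_incl K D)) (linN (@lin_incl K D)).
congr (_ - _); rewrite (cap_lin _ _ (@lin_incl K D)).
by apply: eq_cap => p _; rewrite antipode_incl -(incl_dmul hAd).
Qed.

(** Each side is [- f a b] minus the sum, over the reduced coproducts of [a] and
[b], of the same expression at [a'], [b'] times [f a'' b'']. *)
Lemma pair_antipode_aug a b : f (antipode_aug a) b = f a (antipode_aug b).
Proof.
have ls := lin_antipode_aug.
suff H n F G : (size F + size G < n)%N ->
    f (antipode_aug 'b_F) 'b_G = f 'b_F (antipode_aug 'b_G).
  apply: (bilin_ext (phi := fun a b => f (antipode_aug a) b : K^o)
                    (psi := fun a b => f a (antipode_aug b) : K^o)).
  - exact: (bilin_comp (form_bilin bf) ls (@lin_id _ _)).
  - exact: (bilin_comp (form_bilin bf) (@lin_id _ _) ls).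
  by move=> F G; apply: (H _ F G (leqnn _)).
elim: n F G => // n IH F G; rewrite ltnS => le_n.
rewrite [antipode_aug 'b_F]antipode_aug_rec [antipode_aug 'b_G]antipode_aug_rec.
rewrite (linB (lfl _)) (linB (lfr _)) (linN (lfl _)) (linN (lfr _)).
congr (_ - _); rewrite (cap_lin _ _ (lfl _)) (cap_lin _ _ (lfr _)).
transitivity (cap (fun x y => cap (fun z t =>
    (f (antipode_aug x) z * f y t : K^o)) (codelta Ad 'b_G)) (codelta Ad 'b_F)).
  by apply: (eq_cap (V := K^o)) => p _; rewrite (pair_dmull hf).
rewrite cap_swap; apply: (eq_cap (V := K^o)) => q Gq.
rewrite pair_sym (pair_dmull hf); apply: (eq_cap (V := K^o)) => p Fp.
have /andP[p1 _] := codelta_lt coprec_size cosucc_size Fp.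
have /andP[q1 _] := codelta_lt coprec_size cosucc_size Gq.
rewrite IH 1?pair_sym ?[f 'b_(p.2) _]pair_sym //.
exact: leq_trans (leq_add p1 (ltnW q1)) le_n.
Qed.

Lemma form_antipode x y : form (S x) y = form x (S y).
Proof.
have SE z : S z = counit z *: 1 + incl (antipode_aug (proj z)).
  by rewrite {1}[z]incl_proj lS antipode1 antipode_incl.
have cS z : counit (S z) = counit z.
  by rewrite SE (@lin_counit K D) counit1 counit_incl addr0; apply: mulr1.
have pS z : proj (S z) = antipode_aug (proj z).
  by rewrite SE (@lin_proj K D) proj1 scaler0 add0r inclK.
by rewrite !formE !cS !pS pair_antipode_aug.
Qed.

End Antipode.
End Properties.

Theorem theorem50 (K : fieldType) (D : choiceType) (hD : inhabited D)
    (deg : D -> nat)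
    (Ad : bidendriform K (neforest D)) (hAd : tree_bidendriform Ad)
    (f : AT K D -> AT K D -> K) (hf : bidendriform_pairing Ad Ad f)
    (hf1 : forall d d' : D, f (bullet K d) (bullet K d') = (d == d')%:R)
    (S : {linear HT K D -> HT K D}) (hS : is_antipode S) :
  let form := extend_form f in
  [/\ bilinear_form form,
      inductive_pairing form
    & forall g : HT K D -> HT K D -> K,
        bilinear_form g -> inductive_pairing g ->
        forall x y, g x y = form x y]
  /\ [/\ form_symmetric form,
         form_homogeneous deg form,
         form_nondegenerate form
       & forall x y, form (S x) y = form x (S y)].
Proof.
have bform := form_bilinear hf; have iform := form_inductive hAd hf hf1.
split; split.
- exact: bform.
- exact: iform.
- by move=> g bg ig; apply: (inductive_pairing_unique hAd bg ig bform iform).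
- exact: (form_sym hAd hf hf1).
- exact: (form_graded hAd hf hf1).
- exact: (form_nondeg hAd hf hf1).
apply: (form_antipode hAd hf hf1) => [|x]; first exact: linearP.
exact: (hS x).1.
Qed.
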